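(* Let $d\ge2$ and let $H\subseteq\mathbb N^d$ be a slim semigroup all of whose nonzero elements have all entries positive. Assume that $(1,\dots,1)\in\omega_H$. If $H$ has an Ulrich element $\mathbf b$, then $\mathbf b=(1,\dots,1)$.
   Context: $\mathbb N=\{0,1,2,\dots\}$. An affine semigroup $H\subseteq\mathbb N^d$ is a finitely generated submonoid of $\mathbb N^d$; it is always assumed that the group generated by $H$ is $\mathbb Z^d$. Let $C\subseteq\mathbb R^d$ be the cone generated by $H$. $H$ is normal if $H=C\cap\mathbb Z^d$, and simplicial if $C$ has exactly $d$ extremal rays (one-dimensional faces). $\mathcal N_d$ is the class of normal simplicial affine semigroups in $\mathbb N^d$ generating $\mathbb Z^d$ as a group. For $H\in\mathcal N_d$, the extremal rays of $H$ are the primitive lattice vectors $\mathbf a_1,\dots,\mathbf a_d\in H$ lying on the extremal rays of $C$; they form an $\mathbb R$-basis of $\mathbb R^d$. For $\mathbf z=\sum_i\lambda_i\mathbf a_i$ put $[\mathbf z]_i=\lambda_i$. $B_H$ (the Hilbert basis) is the unique minimal generating set of $H$, and $\omega_H=\mathbb Z^d\cap\operatorname{relint}C$. $H\in\mathcal N_d$ is called slim if $\sum_{i=1}^d[\mathbf c]_i\ge 1$ for every $\mathbf c\in B_H\setminus\omega_H$. Let $K$ be a field. $R=K[H]$ is the subalgebra of $K[x_1,\dots,x_d]$ spanned by the monomials $\mathbf x^{\mathbf h}$, $\mathbf h\in H$; its graded maximal ideal $\mathfrak m$ is generated by $\mathbf x^{\mathbf h}$, $0\ne\mathbf h\in H$.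 The canonical module $\omega_R$ is the ideal of $R$ spanned over $K$ by the monomials $\mathbf x^{\mathbf h}$, $\mathbf h\in\omega_H$. A graded Cohen–Macaulay $R$-module $E$ is Ulrich if its minimal number of generators equals its multiplicity $e(E)$ with respect to $\mathfrak m$; the zero module counts as Ulrich. An element $\mathbf b\in\omega_H$ is called an Ulrich element in $H$ if $\omega_R/\mathbf x^{\mathbf b}R$ is an Ulrich $R$-module. *)

(* Defs.v *)
From HB Require Import structures.
From mathcomp Require Import all_boot all_order all_algebra.
From mathcomp Require Import generic_quotient ring_quotient.
From mathcomp Require Import boolp reals.
From mathcomp Require Import mpoly.

Set Implicit Arguments.
Unset Strict Implicit.
Unset Printing Implicit Defensive.

Import Order.TTheory GRing.Theory Num.Theory.

Local Open Scope ring_scope.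
Local Open Scope quotient_scope.

Definition is_max (P : nat -> Prop) (n : nat) : Prop :=
  P n /\ forall k, P k -> (k <= n)%N.

Definition is_min (P : nat -> Prop) (n : nat) : Prop :=
  P n /\ forall k, P k -> (n <= k)%N.

Definition strict_chain (T : Type) (c : nat -> {pred T}) (k : nat) : Prop :=
  forall i, (i < k)%N -> {subset c i <= c i.+1} /\ ~ {subset c i.+1 <= c i}.

Section SpannedSubmodule.
Variables (R : comNzRingType) (V : lmodType R).

Definition submod_span (S : V -> Prop) : {pred V} := fun v =>
  `[< exists s : seq (R * V),
        (forall x, x \in s -> S x.2) /\ v = \sum_(x <- s) x.1 *: x.2 >].

Lemma submod_span_closed (S : V -> Prop) : submod_closed (submod_span S).
Proof.
split.
  by apply/asboolP; exists [::]; split; [|rewrite big_nil].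
move=> a u v /asboolP[s [Ss ->]] /asboolP[t [St ->]].
apply/asboolP; exists ([seq (a * x.1, x.2) | x <- s] ++ t); split.
  by move=> x; rewrite mem_cat => /orP[/mapP[y ys ->] /=|/St //]; apply: Ss.
rewrite big_cat big_map /= scaler_sumr; congr (_ + _).
by apply: eq_bigr => x _; rewrite scalerA.
Qed.

HB.instance Definition _ (S : V -> Prop) :=
  GRing.isSubmodClosed.Build R V (submod_span S)
    (GRing.submod_closed_semi (submod_span_closed S)).

(* I S, for an ideal I generated by the given elements and a submodule S. *)
Definition smulmod (I : {pred R}) (S : {pred V}) : {pred V} :=
  submod_span (fun v => exists a w, [/\ a \in I, w \in S & v = a *: w]).

HB.instance Definition _ (I : {pred R}) (S : {pred V}) :=
  GRing.SubmodClosed.on (smulmod I S).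

End SpannedSubmodule.

(* Ideals of R, R itself included, are the submodules of R^o. *)
Definition ideal_pow (R : comNzRingType) (I : {pred R}) (n : nat) : {pred R} :=
  iter n (fun J : {pred R} => smulmod I (J : {pred R^o})) predT.

Section SubmoduleType.
Variables (R : comNzRingType) (V : lmodType R) (N : submodClosed V).

Definition submod_type : Type := {v : V | v \in N}.

HB.instance Definition _ := SubChoice.on submod_type.
HB.instance Definition _ := [SubChoice_isSubLmodule of submod_type by <:].

End SubmoduleType.

Section QuotientModule.
Variables (R : comNzRingType) (V : lmodType R) (N : submodClosed V).

(* submodClosed does not inherit from zmodClosed, which Quotient.quot needs. *)
Definition submod_zmod : {pred V} := N.

Lemma submod_zmod_closed : zmod_closed submod_zmod.
Proof. exact/GRing.submod_closedB/submodClosedP. Qed.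

HB.instance Definition _ :=
  GRing.isZmodClosed.Build V submod_zmod submod_zmod_closed.

Definition quotmod : Type := Quotient.quot submod_zmod.

HB.instance Definition _ := GRing.Zmodule.on quotmod.

Local Notation proj := (\pi_(Quotient.quot submod_zmod)).

Definition quotmod_proj (v : V) : quotmod := proj v.

Definition quotmod_scale (a : R) (x : quotmod) : quotmod :=
  quotmod_proj (a *: repr x).

Lemma quotmod_projP (v w : V) : reflect (quotmod_proj v = quotmod_proj w)
  (v - w \in N).
Proof.
have -> : (v - w \in N) = (proj v == proj w).
  exact: (Quotient.idealrBE submod_zmod v w).
exact: eqP.
Qed.

Lemma quotmod_projK (x : quotmod) : quotmod_proj (repr x) = x.
Proof. exact: reprK. Qed.

Lemma quotmod_proj_is_zmod_morphism : zmod_morphism quotmod_proj.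
Proof. exact: pi_is_zmod_morphism. Qed.

HB.instance Definition _ := GRing.isZmodMorphism.Build V quotmod quotmod_proj
  quotmod_proj_is_zmod_morphism.

Lemma quotmod_scale_proj a v :
  quotmod_scale a (quotmod_proj v) = quotmod_proj (a *: v).
Proof.
apply/quotmod_projP; rewrite -scalerBr.
by apply: rpredZ; apply/quotmod_projP; rewrite quotmod_projK.
Qed.

Lemma quotmod_scaleA a b x :
  quotmod_scale a (quotmod_scale b x) = quotmod_scale (a * b) x.
Proof. by rewrite {2}/quotmod_scale quotmod_scale_proj scalerA. Qed.

Lemma quotmod_scale1 : left_id 1 quotmod_scale.
Proof. by move=> x; rewrite /quotmod_scale scale1r quotmod_projK. Qed.

Lemma quotmod_scaleDr : right_distributive quotmod_scale +%R.
Proof.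
move=> a x y; rewrite -[x]quotmod_projK -[y]quotmod_projK.
by rewrite -raddfD !quotmod_scale_proj scalerDr raddfD.
Qed.

Lemma quotmod_scaleDl x : {morph quotmod_scale^~ x : a b / a + b}.
Proof. by move=> a b; rewrite /quotmod_scale scalerDl raddfD. Qed.

HB.instance Definition _ := GRing.Zmodule_isLmodule.Build R quotmod
  quotmod_scaleA quotmod_scale1 quotmod_scaleDr quotmod_scaleDl.

Lemma quotmod_proj_scalable : scalable quotmod_proj.
Proof. by move=> a v; rewrite -quotmod_scale_proj. Qed.

HB.instance Definition _ := GRing.isScalable.Build R V quotmod *:%R
  quotmod_proj quotmod_proj_scalable.

End QuotientModule.

Section ModuleInvariants.
Variables (R : comNzRingType) (E : lmodType R).

Definition mod_length (n : nat) : Prop :=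
  is_max (fun k => exists c : nat -> submodClosed E,
                     strict_chain (fun i => c i : {pred E}) k) n.

Definition min_gens (n : nat) : Prop :=
  is_min (fun k => exists g : 'I_k -> E,
            forall v, exists r : 'I_k -> R, v = \sum_(i < k) r i *: g i) n.

(* Chains of prime ideals containing the annihilator of E. *)
Definition mod_krull_dim (n : nat) : Prop :=
  is_max (fun k => exists p : nat -> prime_idealr R,
    strict_chain (fun i => p i : {pred R}) k /\
    forall i a, (i <= k)%N -> (forall v : E, a *: v = 0) -> a \in p i) n.

(* s`_i is a nonzerodivisor on E/(s`_0, ..., s`_(i-1))E for every i, and
   (s)E is not E. *)
Definition regular_seq (s : seq R) : Prop :=
  (forall i, (i < size s)%N -> forall v : E,
     s`_i *: v \in smulmod (mem (take i s)) predT ->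
     v \in smulmod (mem (take i s)) predT)
  /\ exists v : E, v \notin smulmod (mem s) predT.

Definition mod_grade (I : {pred R}) (n : nat) : Prop :=
  is_max (fun k => exists s : seq R,
    [/\ size s = k, {subset s <= I} & regular_seq s]) n.

End ModuleInvariants.

Definition mod_modulo (R : comNzRingType) (E : lmodType R) (I : {pred R})
    (n : nat) : lmodType R :=
  quotmod (smulmod (ideal_pow I n) predT : submodClosed E).

Section Ulrich.
Variables (R : comNzRingType) (I : {pred R}) (E : lmodType R).

Definition hilbert_samuel_poly (P : {poly rat}) : Prop :=
  exists n0, forall n, (n0 <= n)%N ->
    exists2 l, mod_length (mod_modulo E I n.+1) l & P.[n%:R] = l%:R.

(* The Hilbert-Samuel polynomial has degree dim E and leading coefficient
   e(E) / (dim E)!. *)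
Definition mod_multiplicity (e : nat) : Prop :=
  exists r P, [/\ mod_krull_dim E r, hilbert_samuel_poly P
                & r`!%:R * P`_r = e%:R].

Definition cohen_macaulay : Prop :=
  exists2 r, mod_krull_dim E r & mod_grade E I r.

(* When R is a positively graded algebra over a field, I is its graded maximal
   ideal and E is a finitely generated graded module, E is Cohen-Macaulay iff
   its localization at I is, iff its grade along I is its dimension; and
   min_gens is the minimal number of homogeneous generators. *)
Definition ulrich : Prop :=
  (forall v : E, v = 0) \/
  cohen_macaulay /\ exists2 e, mod_multiplicity e & min_gens E e.

End Ulrich.

Section ConvexGeometry.
Variables (F : realType) (d : nat).
Implicit Types (C D : 'rV[F]_d -> Prop).

Definition aff_hull C (x : 'rV[F]_d) : Prop :=
  exists (n : nat) (t : 'I_n -> F) (c : 'I_n -> 'rV[F]_d),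
    [/\ forall i, C (c i), \sum_(i < n) t i = 1
      & x = \sum_(i < n) t i *: c i].

Definition relint C (x : 'rV[F]_d) : Prop :=
  C x /\ exists2 e : F, 0 < e &
    forall y, aff_hull C y -> (forall i, `|y 0 i - x 0 i| < e) -> C y.

(* The intersections of the cone C with its supporting hyperplanes through the
   origin, and C itself (u = 0). *)
Definition is_face C D : Prop :=
  exists u : 'cV[F]_d, (forall x, C x -> 0 <= (x *m u) 0 0) /\
    forall x, D x <-> C x /\ (x *m u) 0 0 = 0.

Definition extremal_ray C D : Prop :=
  is_face C D /\ exists v, [/\ v != 0, D v & forall x, D x -> exists t, x = t *: v].

End ConvexGeometry.

Definition mvec (A : pzRingType) (d : nat) (h : 'X_{1..d}) : 'rV[A]_d :=
  \row_i (h i)%:R.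

Definition monoid_gen (d : nat) (B : 'X_{1..d} -> Prop) (h : 'X_{1..d}) : Prop :=
  exists2 s : seq 'X_{1..d},
    (forall x, x \in s -> B x) & h = (\sum_(x <- s) x)%MM.

(* The fields express that the monoid is finitely generated and that it
   generates the group Z^d. *)
Record affine_semigroup (d : nat) := AffineSemigroup {
  asg_mem :> {pred 'X_{1..d}};
  asg_fg : exists gs : seq 'X_{1..d},
    forall h, h \in asg_mem <-> monoid_gen (fun x => x \in gs) h;
  asg_group : forall z : 'rV[int]_d, exists s : seq (int * 'X_{1..d}),
    (forall x, x \in s -> x.2 \in asg_mem) /\
    z = \sum_(x <- s) x.1 *: mvec int x.2
}.

Lemma asg0 d (H : affine_semigroup d) : 0%MM \in H.
Proof.
by have [gs gsP] := asg_fg H; apply/gsP; exists [::] => //; rewrite big_nil.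
Qed.

Lemma asgD d (H : affine_semigroup d) h k :
  h \in H -> k \in H -> (h + k)%MM \in H.
Proof.
have [gs gsP] := asg_fg H => /gsP[s Hs ->] /gsP[t Ht ->]; apply/gsP.
exists (s ++ t); last by rewrite big_cat.
by move=> x; rewrite mem_cat => /orP[/Hs|/Ht].
Qed.

Section NormalSimplicial.
Variables (F : realType) (d : nat) (H : affine_semigroup d).

Definition asg_cone (x : 'rV[F]_d) : Prop :=
  exists s : seq (F * 'X_{1..d}),
    (forall y, y \in s -> 0 <= y.1 /\ y.2 \in H) /\
    x = \sum_(y <- s) y.1 *: mvec F y.2.

Definition asg_normal : Prop :=
  forall z : 'rV[int]_d,
    asg_cone (map_mx intr z) <-> exists2 h, h \in H & z = mvec int h.

Definition asg_simplicial : Prop :=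
  exists D : 'I_d -> 'rV[F]_d -> Prop,
    [/\ forall i, extremal_ray asg_cone (D i),
        forall i j, (forall x, D i x <-> D j x) -> i = j
      & forall D', extremal_ray asg_cone D' ->
          exists i, forall x, D' x <-> D i x].

(* The cone lies in the nonnegative orthant, so that its lattice points are
   vectors of natural numbers. *)
Definition omega (h : 'X_{1..d}) : Prop := relint asg_cone (mvec F h).

Definition primitive (h : 'X_{1..d}) : Prop := \big[gcdn/0%N]_(i < d) h i = 1%N.

Definition extremal_vectors (a : 'I_d -> 'X_{1..d}) : Prop :=
  [/\ injective a,
      forall i, [/\ a i \in H, primitive (a i)
                  & exists2 D, extremal_ray asg_cone D & D (mvec F (a i))]
    & forall D, extremal_ray asg_cone D -> exists i, D (mvec F (a i))].

Definition generating_set (B : 'X_{1..d} -> Prop) : Prop :=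
  forall h, h \in H <-> monoid_gen B h.

Definition hilbert_basis (B : 'X_{1..d} -> Prop) : Prop :=
  generating_set B /\
  forall B', generating_set B' -> (forall x, B' x -> B x) ->
    forall x, B x -> B' x.

(* The extremal vectors (up to order) and the Hilbert basis exist and are
   unique, and the coordinates lam of c are determined by c. *)
Definition slim : Prop :=
  [/\ asg_normal, asg_simplicial
    & forall a B, extremal_vectors a -> hilbert_basis B ->
      forall c (lam : 'I_d -> F), B c -> ~ omega c ->
        mvec F c = \sum_(i < d) lam i *: mvec F (a i) ->
        1 <= \sum_(i < d) lam i].

End NormalSimplicial.

Section SemigroupRing.
Variables (K : fieldType) (d : nat) (H : affine_semigroup d).

(* The K-span of the monomials with exponent in H. *)
Definition sgring_pred : {pred {mpoly K[d]}} :=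
  fun p => all (fun h => h \in H) (msupp p).

Lemma sgring_subalg_closed : subalg_closed sgring_pred.
Proof.
split.
- by rewrite unfold_in msupp1 /= asg0.
- move=> a p q /allP Hp /allP Hq; apply/allP => h /msuppD_le.
  by rewrite mem_cat => /orP[/msuppZ_le/Hp|/Hq].
- move=> p q /allP Hp /allP Hq; apply/allP => h /msuppM_le.
  by case/allpairsP => -[h1 h2] /= [h1p h2q ->]; apply: asgD; [apply: Hp|apply: Hq].
Qed.

HB.instance Definition _ := GRing.isSubalgClosed.Build K {mpoly K[d]}
  sgring_pred (GRing.subalg_closed_semi sgring_subalg_closed).

Definition sgring : Type := {p : {mpoly K[d]} | p \in sgring_pred}.

HB.instance Definition _ := SubChoice.on sgring.
HB.instance Definition _ := [SubChoice_isSubAlgebra of sgring by <:].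
HB.instance Definition _ := [SubNzRing_isSubComNzRing of sgring by <:].

Definition sgring_max_ideal : {pred sgring} :=
  @submod_span sgring sgring^o
    (fun p => exists h, [/\ h \in H, h != 0%MM & val p = 'X_[h]]).

End SemigroupRing.

Section CanonicalModule.
Variables (F : realType) (K : fieldType) (d : nat) (H : affine_semigroup d).
Local Notation R := (sgring K H).

Lemma asg_coneD x y :
  asg_cone H x -> asg_cone H y -> asg_cone H (x + y : 'rV[F]_d).
Proof.
move=> [s [Hs ->]] [t [Ht ->]]; exists (s ++ t); split; last by rewrite big_cat.
by move=> z; rewrite mem_cat => /orP[/Hs|/Ht].
Qed.

Lemma asg_cone_mvec h : h \in H -> asg_cone H (mvec F h).
Proof.
move=> Hh; exists [:: (1, h)]; split; last by rewrite big_seq1 scale1r.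
by move=> z; rewrite inE => /eqP ->; split; rewrite ?ler01.
Qed.

Lemma mvecD (A : pzRingType) (h k : 'X_{1..d}) :
  mvec A (h + k)%MM = mvec A h + mvec A k.
Proof. by apply/rowP => i; rewrite !mxE mnmDE natrD. Qed.

Lemma omegaD h k : k \in H -> omega F H h -> omega F H (k + h)%MM.
Proof.
move=> Hk [Ch [e e0 he]]; have Ck := asg_cone_mvec Hk.
split; first by rewrite mvecD; apply: asg_coneD.
exists e => // y [n [t [c [cC t1 yE]]]] ye.
rewrite -[y](subrK (mvec F k)); apply: asg_coneD => //; apply: he => [|i]; last first.
  by have := ye i; rewrite mvecD !mxE opprD addrA.
have C0 : asg_cone H (0 : 'rV[F]_d) by exists [::]; split=> //; rewrite big_nil.
exists n.+2, (fun i : 'I_n.+2 =>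
    match unlift ord0 i with
    | None => 1
    | Some j => if unlift ord0 j is Some l then t l else -1 end),
  (fun i : 'I_n.+2 =>
    match unlift ord0 i with
    | None => 0
    | Some j => if unlift ord0 j is Some l then c l else mvec F k end).
split.
- by move=> i; case: unliftP => // j _; case: unliftP.
- rewrite !big_ord_recl /= !unlift_none liftK unlift_none addrA subrr add0r -[RHS]t1.
  by apply: eq_bigr => i _; rewrite !liftK.
rewrite !big_ord_recl /= !unlift_none liftK unlift_none scaler0 add0r scaleN1r addrC.
by rewrite yE; congr (_ + _); apply: eq_bigr => i _; rewrite !liftK.
Qed.

(* The K-span of the monomials with exponent in omega. *)
Definition omega_pred : {pred R^o} := fun p =>
  all (fun h => `[< omega F H h >]) (msupp (val (p : R))).

Lemma omega_pred_closed : submod_closed omega_pred.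
Proof.
split; first by rewrite unfold_in /= msupp0.
move=> a p q /allP Hp /allP Hq; apply/allP => h.
have -> : val (a *: p + q : R) = val a * val (p : R) + val (q : R).
  by rewrite rmorphD -rmorphM.
move=> /msuppD_le; rewrite mem_cat => /orP[|/Hq //].
case/msuppM_le/allpairsP => -[h1 h2] /= [h1a h2p ->].
by apply/asboolP/omegaD; [apply: (allP (valP (a : R)))|apply/asboolP/Hp].
Qed.

HB.instance Definition _ := GRing.isSubmodClosed.Build R R^o omega_pred
  (GRing.submod_closed_semi omega_pred_closed).

Definition canonical_module : lmodType R :=
  submod_type (omega_pred : submodClosed R^o).

(* The submodule x^b R of the canonical module; for b in omega there is exactly
   one w as below. *)
Definition monomial_submod (b : 'X_{1..d}) : {pred canonical_module} :=
  submod_span (fun w : submod_type (omega_pred : submodClosed R^o) =>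
    val (val w : R) = 'X_[b]).

Definition omega_quotient (b : 'X_{1..d}) : lmodType R :=
  quotmod (monomial_submod b : submodClosed canonical_module).

Definition ulrich_element (b : 'X_{1..d}) : Prop :=
  omega F H b /\ ulrich (@sgring_max_ideal K d H) (omega_quotient b).

End CanonicalModule.

(* Main.v *)
From HB Require Import structures.
Require Import Defs.
From mathcomp Require Import all_boot all_order all_algebra.
From mathcomp Require Import generic_quotient ring_quotient.
From mathcomp Require Import boolp reals mpoly.
From mathcomp Require Import lra zify.

(* Let E = omega_R / x^b R, let lam_i be the coordinates with respect to the
   extremal vectors a_i, and call an exponent outside when it is not in b + H.
   Counting monomials gives the Hilbert-Samuel function of E up to lower order
   terms: an outside exponent w of omega_H has lam_j(w) < lam_j(b) for some j,
   so that w lies in one of finitely many strips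
   rho + sum_(i != j) N a_i, where rho ranges over the lattice points of omega_H
   with all lam_i(rho) <= 1.  Slimness forces the m-adic order of an exponent in
   a strip to be at most its coordinate sum up to a constant.  Hence e(E) is at
   least the number of pairs (rho, j) with lam_j(rho) < lam_j(b).

   On the other hand E is generated by the monomials x^rho with rho outside, so
   an Ulrich module E needs all of them as generators, and each such rho belongs
   to a single pair.  Let 1 = (1,..,1) and suppose that b differs from 1.  As
   nonzero elements of H have positive entries, 1 is outside, and both 1 and 2
   are among the rho, 2 not being a minimal generator.  So 2 is in b + H, which
   leaves only b = 2; but then (1, j) is a pair for all d >= 2 indices j. *)

Set Implicit Arguments.
Unset Strict Implicit.
Unset Printing Implicit Defensive.

Import Order.TTheory GRing.Theory Num.Theory.

Local Open Scope ring_scope.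

(** * Finitely generated cones, Gordan's alternative and exposed rays *)

Section Cones.
Variables (F : realFieldType) (n : nat).
Implicit Types (P Q : 'rV[F]_n -> Prop) (x y g h : 'rV[F]_n) (u : 'cV[F]_n).
Implicit Types (G : seq 'rV[F]_n).

Definition pairing u x : F := (x *m u) 0 0.

Lemma pairingD u x y : pairing u (x + y) = pairing u x + pairing u y.
Proof. by rewrite /pairing mulmxDl mxE. Qed.

Lemma pairingZ u (t : F) x : pairing u (t *: x) = t * pairing u x.
Proof. by rewrite /pairing -scalemxAl mxE. Qed.

Lemma pairing0 u : pairing u 0 = 0.
Proof. by rewrite /pairing mul0mx mxE. Qed.

Lemma pairingDl u v x : pairing (u + v) x = pairing u x + pairing v x.
Proof. by rewrite /pairing mulmxDr mxE. Qed.

Lemma pairingZl (t : F) u x : pairing (t *: u) x = t * pairing u x.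
Proof. by rewrite /pairing -scalemxAr mxE. Qed.

(** An inductive form of the cone allows arguments term by term. The generators form a predicate,
    because both finite lists and indexed families occur. *)
Inductive conic P : 'rV[F]_n -> Prop :=
| conic0 : conic P 0
| conic_cons (t : F) g x : 0 <= t -> P g -> conic P x -> conic P (t *: g + x).

Lemma conicD P x y : conic P x -> conic P y -> conic P (x + y).
Proof.
move=> cx cy; elim: cx => [|t g z t0 Pg _ IH]; first by rewrite add0r.
by rewrite -addrA; apply: conic_cons.
Qed.

Lemma conicZ P (t : F) x : 0 <= t -> conic P x -> conic P (t *: x).
Proof.
move=> t0; elim=> [|s g z s0 Pg _ IH]; first by rewrite scaler0; apply: conic0.
by rewrite scalerDr scalerA; apply: conic_cons => //; apply: mulr_ge0.
Qed.

Lemma conic_gen P g : P g -> conic P g.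
Proof.
move=> Pg; rewrite -[g]scale1r -[_ *: _]addr0.
by apply: conic_cons => //; apply: conic0.
Qed.

Lemma conic_trans P Q x : (forall g, P g -> conic Q g) -> conic P x -> conic Q x.
Proof.
move=> PQ; elim=> [|t g z t0 Pg _ IH]; first exact: conic0.
by apply: conicD IH; apply: conicZ t0 (PQ _ Pg).
Qed.

Lemma conic_mono P Q x : (forall g, P g -> Q g) -> conic P x -> conic Q x.
Proof. by move=> PQ; apply: conic_trans => g /PQ; apply: conic_gen. Qed.

(** The perturbation tool: on the finite list [s], [p] stays positive after adding or subtracting
    [e * q]. *)
Lemma small_scaling (T : eqType) (s : seq T) (p q : T -> F) :
  (forall h : T, h \in s -> 0 < p h) ->
  exists2 e, 0 < e & forall h : T, h \in s -> e * `|q h| < p h.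
Proof.
elim: s => [|h s IH] Hp; first by exists 1.
have [|e e0 He] := IH; first by move=> k ks; apply: Hp; rewrite inE ks orbT.
have ph : 0 < p h by apply: Hp; rewrite mem_head.
have D : 0 < `|q h| + 1 by rewrite ltr_wpDl.
(* The [+ 1] covers [q h = 0] and makes the inequality strict. *)
exists (Num.min e (p h / (`|q h| + 1))).
  by rewrite lt_min e0 divr_gt0.
move=> k; rewrite inE => /orP[/eqP->|ks]; last first.
  by apply: le_lt_trans (He _ ks); apply: ler_wpM2r => //; rewrite ge_min lexx.
apply: (@le_lt_trans _ _ (p h / (`|q h| + 1) * `|q h|)).
  by apply: ler_wpM2r => //; rewrite ge_min lexx orbT.
by rewrite mulrAC ltr_pdivrMr // ltr_pM2l // ltrDl.
Qed.

(* Gordan's theorem of the alternative, by induction on the number of vectors: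
   if u is positive on G and negative on g, project G onto the kernel of u
   along g. *)
Lemma gordan G :
  (exists u, forall g, g \in G -> 0 < pairing u g) \/
  exists2 g, g \in G & conic (fun x => x \in G) (- g).
Proof.
have [m] := ubnP (size G); elim: m G => // m IH [|g G] /=.
  by move=> _; left; exists 0.
rewrite ltnS => sG.
case: (IH G sG) => [[u Hu]|[h hG ch]]; last first.
  right; exists h; first by rewrite inE hG orbT.
  by apply: conic_mono ch => x xG; rewrite inE xG orbT.
case: (eqVneq g 0) => [->|g0].
  by right; exists 0; [rewrite mem_head|rewrite oppr0; apply: conic0].
case: (ltrgt0P (pairing u g)) => [ug|ug|ug].
- by left; exists u => h; rewrite inE => /orP[/eqP->|/Hu].
- pose tau h := pairing u h / - pairing u g.
  pose pr h := h + tau h *: g.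
  have tau0 h : h \in G -> 0 < tau h.
    by move=> /Hu uh; rewrite divr_gt0 // oppr_gt0.
  have upr h : pairing u (pr h) = 0.
    rewrite pairingD pairingZ /tau invrN mulrN mulNr divfK ?subrr //.
    by rewrite lt_eqF.
  have := IH (map pr G); rewrite size_map => /(_ sG) [[v Hv]|[_ /mapP[h hG ->] ch]].
    have [|e e0 He] := @small_scaling _ G (fun h => pairing v (pr h)) tau.
      by move=> h hG; apply: Hv; apply: map_f.
    (* This [k] gives [v + k *: u] the value [e] at [g]. Its value at [h] in [G] is that of [v] at
       the projection, less [tau h * e], hence still positive. *)
    pose k := (e - pairing v g) / pairing u g.
    have wg : pairing (v + k *: u) g = e.
      by rewrite pairingDl pairingZl divfK ?lt_eqF // addrC subrK.
    left; exists (v + k *: u) => h; rewrite inE => /orP[/eqP->|hG].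
      by rewrite wg.
    have -> : pairing (v + k *: u) h
        = pairing (v + k *: u) (pr h) - tau h * pairing (v + k *: u) g.
      by rewrite [in RHS]pairingD pairingZ addrK.
    rewrite wg pairingDl pairingZl upr mulr0 addr0 subr_gt0 mulrC.
    by rewrite -[tau h]gtr0_norm ?He // tau0.
  right; exists h; first by rewrite inE hG orbT.
  have -> : - h = - pr h + tau h *: g by rewrite opprD subrK.
  apply: conicD; last first.
    by apply: conicZ; [apply/ltW/tau0|apply: conic_gen; rewrite mem_head].
  apply: conic_trans ch => _ /mapP[k kG ->].
  apply: conicD; first by apply: conic_gen; rewrite inE kG orbT.
  by apply: conicZ; [apply/ltW/tau0|apply: conic_gen; rewrite mem_head].
(* If [u] vanishes at [g], it is tilted slightly towards [g^T], which is positive at [g]. *)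
- have [e e0 He] := @small_scaling _ G (pairing u) (pairing g^T) Hu.
  have gg : 0 < pairing g^T g.
    rewrite /pairing mxE lt_neqAle eq_sym.
    have sq i : true -> 0 <= g 0 i * g^T i 0 by rewrite mxE -expr2 sqr_ge0.
    rewrite sumr_ge0 // andbT psumr_eq0 //; apply: contraNN g0 => /allP H0.
    apply/eqP/rowP => i; have := H0 i; rewrite mem_index_enum => /(_ isT) /=.
    by rewrite !mxE mulf_eq0 orbb => /eqP.
  left; exists (u + e *: g^T) => h; rewrite pairingDl pairingZl inE.
  case/orP=> [/eqP->|hG]; first by rewrite ug add0r mulr_gt0.
  rewrite -[_ * _]opprK subr_gt0; apply: le_lt_trans (He _ hG).
  by rewrite -mulrN ler_pM2l // -normrN ler_norm.
Qed.

(** Generators lying in the cone of the others are discarded one after another. The filter removes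
    all copies of [g], so the length drops and repetitions cause no trouble. *)
Lemma irredundant_generators G :
  exists G1, [/\ {subset G1 <= G},
    forall g, g \in G -> conic (fun x => x \in G1) g
    & forall g, g \in G1 -> ~ conic (fun x => x \in [seq h <- G1 | h != g]) g].
Proof.
have [m] := ubnP (size G); elim: m G => // m IH G sG.
have [[g gG cg]|H] := pselect (exists2 g, g \in G &
    conic (fun x => x \in [seq h <- G | h != g]) g); last first.
  exists G; split=> // [g gG|g gG cg]; first exact: conic_gen.
  by apply: H; exists g.
have [|G1 [sub gen irr]] := IH [seq h <- G | h != g].
  rewrite size_filter -ltnS; apply: leq_trans sG.
  rewrite -(count_predC (fun h => h != g) G) ltnS -addn1 leq_add2l -has_count.
  by apply/hasP; exists g => //=; rewrite negbK.
exists G1; split=> // [h /sub|h hG]; first by rewrite mem_filter => /andP[].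
have [hg|hg] := eqVneq h g; first by rewrite hg; apply: conic_trans cg.
by apply: gen; rewrite mem_filter hg.
Qed.

(** Project [G] along [g] onto the kernel of [pos] and apply Gordan. A functional positive on the
    projections, corrected by a multiple of [pos] so as to vanish at [g], is the required one; the
    other alternative would put [g] into the cone of [G]. *)
Lemma exposing_functional (pos : 'cV[F]_n) G g :
  (forall h, h \in G -> 0 < pairing pos h) -> 0 < pairing pos g ->
  ~ conic (fun x => x \in G) g ->
  exists2 u, pairing u g = 0 & forall h, h \in G -> 0 < pairing u h.
Proof.
move=> posG posg ncg; pose c h := pairing pos h / pairing pos g.
pose pr h := h - c h *: g.
have ppr h : pairing pos (pr h) = 0.
  by rewrite pairingD -scaleNr pairingZ mulNr divfK ?subrr ?gt_eqF.
have c0 h : h \in G -> 0 < c h by move=> /posG ph; rewrite divr_gt0.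
case: (gordan (map pr G)) => [[v Hv]|[_ /mapP[h hG ->] ch]].
  exists (v - (pairing v g / pairing pos g) *: pos) => [|h hG].
    by rewrite pairingDl -scaleNr pairingZl mulNr divfK ?subrr ?gt_eqF.
  set w := v - _.
  have wg : pairing w g = 0.
    by rewrite pairingDl -scaleNr pairingZl mulNr divfK ?subrr ?gt_eqF.
  have -> : pairing w h = pairing w (pr h).
    by rewrite pairingD -scaleNr pairingZ wg mulr0 addr0.
  rewrite pairingDl -scaleNr pairingZl ppr mulr0 addr0.
  by apply/Hv/map_f.
(* Replacing each projection [pr k] by [k] costs a nonnegative multiple of [g]; [s] collects these
   costs. *)
have [s s0 cs] : exists2 s, 0 <= s & conic (fun x => x \in G) (- pr h + s *: g).
  elim: ch => [|t _ x t0 /mapP[k kG ->] _ [s s0 cs]].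
    by exists 0 => //; rewrite scale0r addr0; apply: conic0.
  exists (s + t * c k); first by rewrite addr_ge0 // mulr_ge0 // ltW // c0.
  have -> : t *: pr k + x + (s + t * c k) *: g = t *: k + (x + s *: g).
    rewrite /pr scalerBr scalerDl scalerA -!addrA; congr (_ + _).
    by rewrite addrC -!addrA subrr addr0.
  exact: conic_cons.
case: ncg.
have cs0 : 0 < s + c h by rewrite ltr_wpDl // c0.
(* As [- pr h = c h *: g - h], the bracket is [(s + c h) *: g]. *)
have -> : g = (s + c h)^-1 *: (h + (- pr h + s *: g)).
  rewrite /pr opprB addrA addrCA subrr addr0 -scalerDl [c h + s]addrC.
  by rewrite scalerA mulVf ?scale1r // gt_eqF.
apply: conicZ; first by rewrite invr_ge0 ltW.
by apply: conicD cs; apply: conic_gen.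
Qed.

End Cones.

(** * Extremal rays of the cone of an affine semigroup *)

Lemma pairing_const1_mvec (F : realFieldType) d (h : 'X_{1..d}) :
  pairing (const_mx 1) (mvec F h) = (mdeg h)%:R.
Proof.
rewrite /pairing mxE mdegE natr_sum; apply: eq_bigr => i _.
by rewrite !mxE mulr1.
Qed.

Lemma primitive_divisor d (h : 'X_{1..d}) : h != 0%MM ->
  exists a m, [/\ primitive a, (0 < m)%N & h = (a *+ m)%MM].
Proof.
move=> h0; pose m := \big[gcdn/0%N]_(i < d) h i.
have mh i : (m %| h i)%N by apply: (@biggcdn_inf _ i).
have m0 : (0 < m)%N.
  rewrite lt0n; apply: contraNneq h0 => m0; apply/eqP/mnmP => i.
  by have := mh i; rewrite m0 dvd0n mnm0E => /eqP.
exists [multinom (h i %/ m)%N | i < d], m; split=> //; last first.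
  by apply/mnmP => i; rewrite mulmnE mnmE divnK.
apply/eqP; rewrite -(eqn_pmul2l m0) muln1 -[X in _ == X]/m.
rewrite (big_endo (muln m)) ?muln0 //; last by move=> x y; rewrite muln_gcdr.
by apply/eqP/eq_bigr => i _; rewrite mnmE mulnC divnK.
Qed.

Section Rays.
Variables (F : realType) (d : nat) (H : affine_semigroup d).
Implicit Types (x : 'rV[F]_d).

Lemma mvec0 (A : pzRingType) : mvec A (0%MM : 'X_{1..d}) = 0.
Proof. by apply/rowP => i; rewrite !mxE mnm0E. Qed.

Lemma mvecMn (A : pzRingType) (h : 'X_{1..d}) m : mvec A (h *+ m)%MM = m%:R *: mvec A h.
Proof. by apply/rowP => i; rewrite !mxE mulmnE mulnC natrM. Qed.

Lemma mvec_int_inj : injective (@mvec int d).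
Proof.
move=> h k /rowP hk; apply/mnmP => i; have := hk i.
by rewrite !mxE => /eqP; rewrite eqr_nat => /eqP.
Qed.

Lemma map_mvec (h : 'X_{1..d}) : map_mx intr (mvec int h) = mvec F h.
Proof. by apply/rowP => i; rewrite !mxE rmorph_nat. Qed.

Lemma asg_coneZ (t : F) x : 0 <= t -> asg_cone H x -> asg_cone H (t *: x).
Proof.
move=> t0 [s [Hs ->]]; exists [seq (t * y.1, y.2) | y <- s]; split.
  by move=> _ /mapP[y /Hs[y0 yH] ->]; split=> //=; apply: mulr_ge0.
by rewrite big_map scaler_sumr; apply: eq_bigr => y _; rewrite scalerA.
Qed.

Lemma asg_cone0 : asg_cone H (0 : 'rV[F]_d).
Proof. by exists [::]; split; rewrite ?big_nil. Qed.

Lemma conic_asg_cone (P : 'rV[F]_d -> Prop) x :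
  (forall v, P v -> asg_cone H v) -> conic P x -> asg_cone H x.
Proof.
move=> PH; elim=> [|t g y t0 Pg _ IH]; first exact: asg_cone0.
by apply: asg_coneD IH; apply: asg_coneZ t0 (PH _ Pg).
Qed.

Lemma asg_cone_conic (P : 'rV[F]_d -> Prop) x :
  (forall h, h \in H -> conic P (mvec F h)) -> asg_cone H x -> conic P x.
Proof.
move=> PH [s [Hs ->]]; elim: s Hs => [|y s IH] Hs.
  by rewrite big_nil; apply: conic0.
rewrite big_cons; apply: conicD; last first.
  by apply: IH => z zs; apply: Hs; rewrite inE zs orbT.
by have [|y0 /PH yH] := Hs y; rewrite ?mem_head //; apply: conicZ.
Qed.

Lemma nonzero_generators : exists gs : seq 'X_{1..d},
  [/\ forall g, g \in gs -> g \in H, 0%MM \notin gs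
    & forall x, asg_cone H x -> conic (fun v => v \in map (@mvec F d) gs) x].
Proof.
have [gs gsP] := asg_fg H; exists [seq g <- gs | g != 0%MM]; split.
- move=> g; rewrite mem_filter => /andP[_ gg]; apply/gsP.
  by exists [:: g]; rewrite ?big_seq1 // => y; rewrite inE => /eqP->.
- by rewrite mem_filter eqxx.
move=> x; apply: asg_cone_conic => h /gsP[s Hs ->].
elim: s Hs => [|y s IH] Hs; first by rewrite big_nil mvec0; apply: conic0.
rewrite big_cons mvecD; apply: conicD; last first.
  by apply: IH => z zs; apply: Hs; rewrite inE zs orbT.
have [->|y0] := eqVneq y 0%MM; first by rewrite mvec0; apply: conic0.
by apply/conic_gen/map_f; rewrite mem_filter y0 Hs // mem_head.
Qed.

(** Every generator other than [g] contributes a positive multiple of its coefficient to [u], so the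
    value 0 leaves only multiples of [g]: the face cut out by [u] is the ray of [g]. *)
Lemma conic_exposed (G : seq 'rV[F]_d) g u x :
  pairing u g = 0 -> (forall h, h \in [seq h <- G | h != g] -> 0 < pairing u h) ->
  conic (fun v => v \in G) x ->
  0 <= pairing u x /\ (pairing u x = 0 -> exists t, x = t *: g).
Proof.
move=> ug uG; elim=> [|t h y t0 hG _ [IH1 IH2]].
  by rewrite pairing0; split=> // _; exists 0; rewrite scale0r.
rewrite pairingD pairingZ; have [->|hg] := eqVneq h g.
  rewrite ug mulr0 add0r; split=> // /IH2[s ->]; exists (t + s).
  by rewrite scalerDl.
have uh : 0 < pairing u h by apply: uG; rewrite mem_filter hg.
have tu : 0 <= t * pairing u h by rewrite mulr_ge0 // ltW.
split; first exact: addr_ge0.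
move=> /eqP; rewrite paddr_eq0 // mulf_eq0 (gt_eqF uh) orbF => /andP[/eqP-> /eqP].
by move=> /IH2[s ->]; exists s; rewrite scale0r add0r.
Qed.

(** The cone is pointed: the sum of entries is positive on its nonzero generators, which are vectors
    of natural numbers. *)
Lemma cone_pos x : asg_cone H x -> x != 0 -> 0 < pairing (const_mx 1) x.
Proof.
have [gs [gsH gs0 gsC]] := nonzero_generators.
move=> /gsC; elim=> [|t _ y t0 /mapP[g gg ->] cy IH]; first by rewrite eqxx.
have pg : 0 < pairing (const_mx 1) (mvec F g).
  rewrite pairing_const1_mvec ltr0n lt0n mdeg_eq0.
  by apply: contraNneq gs0 => <-.
have [->|y0] := eqVneq y 0; rewrite pairingD pairingZ.
  rewrite addr0 pairing0 addr0 scaler_eq0 negb_or => /andP[tn0 _].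
  by rewrite mulr_gt0 // lt_neqAle eq_sym tn0.
by rewrite ltr_wpDl ?IH // mulr_ge0 // ltW.
Qed.

(* The rays of an irredundant generating set are exposed. *)
Lemma extremal_rays_generate (D : 'I_d -> 'rV[F]_d -> Prop) (v : 'I_d -> 'rV[F]_d) :
  (forall D', extremal_ray (asg_cone H) D' -> exists i, forall x, D' x <-> D i x) ->
  (forall i, D i (v i) /\ v i != 0) ->
  forall x, asg_cone H x -> conic (fun y => exists i, y = v i) x.
Proof.
move=> DP Dv x Cx; have [gs [gsH gs0 gsC]] := nonzero_generators.
have [G [Ggs gsG irr]] := irredundant_generators (map (@mvec F d) gs).
have CG y : asg_cone H y -> conic (fun v => v \in G) y.
  by move=> /gsC; apply: conic_trans.
have GC g : g \in G -> asg_cone H g.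
  by move=> /Ggs/mapP[h /gsH hH ->]; apply: asg_cone_mvec.
have Gpos g : g \in G -> 0 < pairing (const_mx 1) g.
  move=> /Ggs/mapP[h hg ->]; rewrite pairing_const1_mvec ltr0n lt0n mdeg_eq0.
  by apply: contraNneq gs0 => <-.
apply: conic_trans (CG _ Cx) => g gG.
have Gpos' h : h \in [seq h <- G | h != g] -> 0 < pairing (const_mx 1) h.
  by rewrite mem_filter => /andP[_ /Gpos].
have [u ug uG] := exposing_functional Gpos' (Gpos _ gG) (irr _ gG).
have g0 : g != 0 by apply: contraTneq (Gpos _ gG) => ->; rewrite pairing0 ltxx.
have [|i Di] := DP (fun x => asg_cone H x /\ pairing u x = 0).
  split; first by exists u; split=> // y /CG cy; case: (conic_exposed ug uG cy).
  exists g; split=> //; first by split=> //; apply: GC.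
  by move=> y [/CG cy uy]; case: (conic_exposed ug uG cy) => _; apply.
have [/Di[Cv uv] v0] := Dv i.
have [t vt] := (conic_exposed ug uG (CG _ Cv)).2 uv.
have t0 : 0 < t.
  by have := cone_pos Cv v0; rewrite vt pairingZ pmulr_lgt0 // Gpos.
have -> : g = t^-1 *: v i by rewrite vt scalerA mulVf ?scale1r // gt_eqF.
by apply: conicZ; [rewrite invr_ge0 ltW|apply: conic_gen; exists i].
Qed.

(** In a conical combination for a nonzero point of the ray, [u] must vanish at some generator.
    Divided by the gcd of its entries, this generator stays in the cone, and normality puts it in
    [H]. *)
Lemma extremal_ray_primitive (D : 'rV[F]_d -> Prop) :
  asg_normal F H -> extremal_ray (asg_cone H) D ->
  exists a, [/\ a \in H, primitive a, a != 0%MM & D (mvec F a)].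
Proof.
move=> nH [[u [uC uD]] [v [v0 /uD[Cv uv] _]]].
have [gs [gsH gs0 gsC]] := nonzero_generators.
have [g gg ug] : exists2 g, g \in gs & pairing u (mvec F g) = 0.
  move: (gsC _ Cv) v0 uv.
  elim=> [|t _ y t0 /mapP[g gg ->] cy IH] v0; first by rewrite eqxx in v0.
  rewrite -[(_ *m u) 0 0]/(pairing u _).
  rewrite pairingD pairingZ => /eqP.
  have ug : 0 <= pairing u (mvec F g) by apply/uC/asg_cone_mvec/gsH.
  have uy : 0 <= pairing u y.
    apply/uC/conic_asg_cone/cy => _ /mapP[h /gsH hH ->].
    exact: asg_cone_mvec.
  rewrite paddr_eq0 ?mulr_ge0 // mulf_eq0.
  case/andP=> /orP[/eqP t00|/eqP ug0] /eqP uy0; last by exists g.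
  by apply: IH => //; move: v0; rewrite t00 scale0r add0r.
have g0 : g != 0%MM by apply: contraNneq gs0 => <-.
have [a [m [pa m0 gE]]] := primitive_divisor g0.
have mF : m%:R != 0 :> F by rewrite pnatr_eq0 -lt0n.
have aE : mvec F a = m%:R^-1 *: mvec F g.
  by rewrite gE mvecMn scalerA mulVf ?scale1r.
have Ca : asg_cone H (mvec F a).
  by rewrite aE; apply: asg_coneZ; rewrite ?invr_ge0 //; apply/asg_cone_mvec/gsH.
exists a; split=> //.
- by have /nH[h hH /mvec_int_inj->] : asg_cone H (map_mx intr (mvec int a) : 'rV[F]_d);
    rewrite ?map_mvec.
- by apply: contraNneq g0 => a0; rewrite gE a0; apply/eqP/mnmP => i;
    rewrite mulmnE mnm0E.
apply/uD; split=> //; rewrite aE.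
by rewrite -[LHS]/(pairing u _) pairingZ ug mulr0.
Qed.

End Rays.

(** * The irreducible elements as Hilbert basis *)

Section HilbertBasis.
Variables (d : nat) (H : affine_semigroup d).
Implicit Types (c h k : 'X_{1..d}).

Definition irreducible h :=
  [/\ h \in H, h != 0%MM & forall k l, k \in H -> l \in H -> h = (k + l)%MM ->
     k = 0%MM \/ l = 0%MM].

Lemma mem_sum_asg (s : seq 'X_{1..d}) :
  (forall x, x \in s -> x \in H) -> (\sum_(x <- s) x)%MM \in H.
Proof.
elim: s => [|y s IH] Hs; first by rewrite big_nil asg0.
rewrite big_cons; apply: asgD; first exact/Hs/mem_head.
by apply: IH => x xs; apply: Hs; rewrite inE xs orbT.
Qed.

Lemma irreducible_summand h : h \in H -> h != 0%MM ->
  exists c k, [/\ irreducible c, k \in H & h = (c + k)%MM].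
Proof.
have [m] := ubnP (mdeg h); elim: m h => // m IH h sh hH h0.
have [irr|nirr] := pselect (irreducible h).
  by exists h, 0%MM; rewrite addm0; split=> //; apply: asg0.
have [k [l [kH lH hE k0 l0]]] : exists k l,
    [/\ k \in H, l \in H, h = (k + l)%MM, k != 0%MM & l != 0%MM].
  apply: contrapT => nex; apply: nirr; split=> // k l kH lH hE.
  have [->|k0] := eqVneq k 0%MM; first by left.
  have [->|l0] := eqVneq l 0%MM; first by right.
  by case: nex; exists k, l.
have [|c [k' [cI k'H kE]]] := IH k _ kH k0.
  move: sh; rewrite hE mdegD ltnS; apply: leq_trans.
  by rewrite -addn1 leq_add2l lt0n mdeg_eq0.
exists c, (k' + l)%MM; split=> //; first exact: asgD.
by rewrite hE kE addmA.
Qed.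

(** This forces irreducible elements into every generating set, hence their minimality and
    finiteness. *)
Lemma irreducible_sum (s : seq 'X_{1..d}) h : irreducible h ->
  (forall x, x \in s -> x \in H) -> h = (\sum_(x <- s) x)%MM -> h \in s.
Proof.
move=> [hH h0 hI]; elim: s => [|y s IH] Hs hE.
  by move: h0; rewrite hE big_nil eqxx.
have Hs' x : x \in s -> x \in H by move=> xs; apply: Hs; rewrite inE xs orbT.
rewrite inE; rewrite big_cons in hE.
have [|y0|l0] := hI _ _ (Hs _ (mem_head _ _)) _ hE.
- exact: mem_sum_asg.
- by rewrite IH ?orbT // hE y0 add0m.
by rewrite hE l0 addm0 eqxx.
Qed.

Lemma irreducible_hilbert_basis : hilbert_basis H irreducible.
Proof.
split=> [h|B' B'gen B'sub x xI]; last first.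
  have [xH _ _] := xI.
  have /B'gen[s sB' xE] := xH.
  apply/sB'/(irreducible_sum xI) => // y /sB' yB'; apply/B'gen.
  by exists [:: y]; rewrite ?big_seq1 // => z; rewrite inE => /eqP->.
split=> [hH|[s Hs ->]]; last by apply: mem_sum_asg => x /Hs[].
have [m] := ubnP (mdeg h); elim: m h hH => // m IH h hH sh.
have [->|h0] := eqVneq h 0%MM; first by exists [::]; rewrite ?big_nil.
have [c [k [cI kH hE]]] := irreducible_summand hH h0.
have [_ c0 _] := cI.
have [|s Hs kE] := IH k kH.
  move: sh; rewrite hE mdegD ltnS; apply: leq_trans.
  by rewrite -add1n leq_add2r lt0n mdeg_eq0.
exists (c :: s); last by rewrite big_cons -kE.
by move=> x; rewrite inE => /orP[/eqP->|/Hs].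
Qed.

Lemma finitely_many_irreducibles :
  exists gs : seq 'X_{1..d}, forall h, irreducible h -> h \in gs.
Proof.
have [gs gsP] := asg_fg H; exists gs => h hI.
have [hH _ _] := hI; have /gsP[s sgs hE] := hH.
apply/sgs/(irreducible_sum hI) => // x /sgs xgs; apply/gsP.
by exists [:: x]; rewrite ?big_seq1 // => z; rewrite inE => /eqP->.
Qed.

End HilbertBasis.

(* The last field is what slimness says about nonzero elements: an irreducible
   summand whose coordinate sum is below 1 lies in the interior of the cone, and
   interior_gap exists because there are finitely many irreducible elements. *)
Record simplicial_frame (F : realType) (d : nat) (H : affine_semigroup d) :=
  SimplicialFrame {
    ray : 'I_d -> 'X_{1..d};
    ray_coord : 'I_d -> 'X_{1..d} -> F;
    interior_gap : F;
    ray_coordD : forall i h k, ray_coord i (h + k)%MM = ray_coord i h + ray_coord i k;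
    ray_coord_ge0 : forall i h, h \in H -> 0 <= ray_coord i h;
    ray_mem : forall i, ray i \in H;
    ray_coord_ray : forall i j, ray_coord i (ray j) = (i == j)%:R;
    ray_coord_diff : forall h k, (forall i, ray_coord i k <= ray_coord i h) ->
      exists2 g, g \in H & h = (k + g)%MM;
    omega_coord : forall h, omega F H h <-> forall i, 0 < ray_coord i h;
    interior_gap_gt0 : 0 < interior_gap;
    slim_summand : forall h, h \in H -> h != 0%MM ->
      exists c k, [/\ c \in H, k \in H, h = (c + k)%MM
        & 1 <= \sum_(i < d) ray_coord i c \/ forall i, interior_gap <= ray_coord i c]
  }.

(** * Coordinates of a slim semigroup with respect to its extremal vectors *)

Section Frame.
Variables (F : realType) (d : nat) (H : affine_semigroup d).

(** [H] generates the group Z^d, so the row span contains the unit vectors. *)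
Lemma rowspan_asg (A : 'M[F]_d) :
  (forall h, h \in H -> (mvec F h <= A)%MS) -> A \in unitmx.
Proof.
move=> HA; rewrite -row_full_unit -sub1mx; apply/row_subP => i.
have [s [sH sE]] := asg_group H (delta_mx 0 i).
have -> : row i 1%:M = map_mx intr (delta_mx 0 i : 'rV[int]_d) :> 'rV[F]_d.
  by rewrite rowE mulmx1 map_delta_mx.
rewrite sE raddf_sum /= big_seq; apply: summx_sub => x /sH xH.
by rewrite map_mxZ map_mvec scalemx_sub // HA.
Qed.

(** The rays generate the cone, so the extremal vectors form an invertible matrix whose inverse
    yields the coordinates. The cone becomes the nonnegative orthant, and normality turns a lattice
    difference with nonnegative coordinates into an element of [H]. *)
Lemma slim_frame : slim F H -> inhabited (simplicial_frame F H).
Proof.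
move=> [nH [D [Dext Dinj Dall]] slimH].
have [a aP] := choice (fun i => extremal_ray_primitive nH (Dext i)).
have aH i : a i \in H by have [] := aP i.
have aD i : D i (mvec F (a i)) by have [] := aP i.
have a0 i : mvec F (a i) != 0.
  have [_ _ ai0 _] := aP i; apply: contraNneq ai0 => E; apply/eqP/mnmP => j.
  by move/rowP/(_ j): E; rewrite !mxE mnm0E => /eqP; rewrite pnatr_eq0 => /eqP.
have exta : extremal_vectors F H a.
  split=> [i j E|i|D' D'ext].
  - apply: Dinj => x.
    (* The extremal vector determines its ray, whence the injectivity of [a]. *)
    have ray k y : D k y <-> asg_cone H y /\ exists t, y = t *: mvec F (a k).
      have [[u [uC uD]] [v [v0 Dv Dt]]] := Dext k; split.
        have [s sE] := Dt _ (aD k); move=> Dy; split; first by case/uD: Dy.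
        have [t tE] := Dt _ Dy; exists (t / s); rewrite sE scalerA divfK //.
        by apply: contraNneq (a0 k) => s0; rewrite sE s0 scale0r.
      move=> [Cy [t tE]]; apply/uD; split=> //.
      have /uD[_ uk] := aD k.
      by rewrite tE -[LHS]/(pairing u _) pairingZ [pairing _ _]uk mulr0.
    by rewrite !ray E.
  - by have [? ? ? ?] := aP i; split=> //; exists (D i).
  - by have [i Di] := Dall _ D'ext; exists i; apply/Di.
pose A : 'M[F]_d := \matrix_i mvec F (a i).
have Crays : forall x, asg_cone H x -> conic (fun y => exists i, y = mvec F (a i)) x.
  by apply: (extremal_rays_generate (v := fun i => mvec F (a i)) Dall) => i.
have Au : A \in unitmx.
  apply: rowspan_asg => h hH; elim: (Crays _ (asg_cone_mvec F hH)) => [|t g x _ [i ->] _ IH].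
    exact: sub0mx.
  apply: addmx_sub IH; apply: scalemx_sub.
  by rewrite -[mvec F (a i)](rowK (fun i => mvec F (a i))) row_sub.
pose co i (x : 'rV[F]_d) := (x *m invmx A) 0 i.
have coD i x y : co i (x + y) = co i x + co i y by rewrite /co mulmxDl mxE.
have coZ i t x : co i (t *: x) = t * co i x by rewrite /co -scalemxAl mxE.
have co_a i j : co i (mvec F (a j)) = (i == j)%:R.
  rewrite /co -[mvec F (a j)](rowK (fun i => mvec F (a i))) -row_mul.
  by rewrite mulmxV // !mxE eq_sym.
have coE x : x = \sum_i co i x *: mvec F (a i).
  rewrite -[LHS](mulmxKV Au) mulmx_sum_row; apply: eq_bigr => i _.
  by rewrite rowK.
have co_ge0 i x : asg_cone H x -> 0 <= co i x.
  move=> /Crays; elim=> [|t g y t0 [j ->] _ IH].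
    by rewrite /co mul0mx mxE.
  by rewrite coD coZ co_a addr_ge0 ?mulr_ge0.
have co_cone x : (forall i, 0 <= co i x) -> asg_cone H x.
  move=> x0; rewrite [x]coE; apply: (big_ind (asg_cone H)) => [|u v|i _].
  - exact: asg_cone0.
  - exact: asg_coneD.
  - exact/asg_coneZ/asg_cone_mvec.
have co_diff h k : (forall i, co i (mvec F k) <= co i (mvec F h)) ->
    exists2 g, g \in H & h = (k + g)%MM.
  move=> kh; have [|g gH gE] := (nH (mvec int h - mvec int k)).1.
    rewrite map_mxB !map_mvec; apply: co_cone => i.
    by rewrite coD -scaleN1r coZ mulN1r subr_ge0.
  exists g => //; apply: (@mvec_int_inj d).
  by rewrite mvecD -gE addrC subrK.
have omega_co h : omega F H h <-> forall i, 0 < co i (mvec F h).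
  split=> [[Ch [e e0 He]] i|hpos].
    (* [m] exceeds every entry of [a i], so moving by [(e / m) *: a i] changes each entry by less
       than [e]. The moved point is still in the cone, so coordinate [i] was at least [e / m]. *)
    pose m : F := 1 + \sum_j (a i j)%:R.
    have m0 : 0 < m by rewrite ltr_wpDr // sumr_ge0.
    pose t := e / m.
    have t0 : 0 < t by rewrite divr_gt0.
    suff /(co_ge0 i) : asg_cone H (mvec F h - t *: mvec F (a i)).
      by rewrite coD -scaleNr coZ co_a eqxx mulr1 subr_ge0; apply: lt_le_trans.
    apply: He => [|j].
      (* The third point, 0 with weight [t], brings the sum of the weights to 1. *)
      exists 3%N, (tnth [tuple 1; - t; t]),
        (tnth [tuple mvec F h; mvec F (a i); 0]); split.
      - move=> j; case/tnthP: (mem_tnth j [tuple mvec F h; mvec F (a i); 0]) => l ->.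
        have := mem_tnth l [tuple mvec F h; mvec F (a i); 0].
        rewrite !inE => /or3P[] /eqP->; rewrite ?Ch //; last exact: asg_cone0.
        exact: asg_cone_mvec.
      - by rewrite !big_ord_recl big_ord0 !(tnth_nth 0) /= addr0 addNr addr0.
      - rewrite !big_ord_recl big_ord0 !(tnth_nth 0) /= !addr0 scaler0 addr0.
        by rewrite scale1r scaleNr.
    rewrite !mxE addrAC subrr add0r normrN ger0_norm; last first.
      by rewrite mulr_ge0 // ltW.
    rewrite /t mulrAC ltr_pdivrMr // ltr_pM2l // /m (bigD1 j) //=.
    rewrite ltr_pwDl // lerDl; apply: sumr_ge0 => *; exact: ler0n.
  split; first by apply: co_cone => i; apply/ltW.
  (* Changing all entries by less than [e] moves coordinate [i] by at most [e * q i]. *)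
  pose q i := \sum_j `|invmx A j i|.
  have [e e0 He] := @small_scaling F 'I_d (enum 'I_d) (fun i => co i (mvec F h)) q
    (fun i _ => hpos i).
  exists e => // y _ ye; apply: co_cone => i.
  have -> : y = mvec F h + (y - mvec F h) by rewrite addrC subrK.
  rewrite coD -[co i (_ - _)]opprK subr_ge0; apply/ltW.
  apply: le_lt_trans (He i (mem_enum _ i)); apply: le_trans (ler_norm _) _.
  rewrite normrN (@ger0_norm _ (q i)) ?sumr_ge0 // /co mxE.
  apply: le_trans (ler_norm_sum _ _ _) _; rewrite mulr_sumr.
  apply: ler_sum => j _; rewrite normrM ler_wpM2r //.
  by have := ye j; rewrite !mxE => /ltW.
have [gs gsP] := finitely_many_irreducibles H.
(* The gap [e] lies below all positive coordinates of the finitely many listed elements. *)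
have [e e0 He] := @small_scaling F ('I_d * 'X_{1..d})%type
  [seq x <- [seq (i, g) | i <- enum 'I_d, g <- gs] | 0 < co x.1 (mvec F x.2)]
  (fun x => co x.1 (mvec F x.2)) (fun _ => 1)
  (fun x => ltac:(by rewrite mem_filter => /andP[])).
constructor.
apply: (@SimplicialFrame F d H a (fun i h => co i (mvec F h)) e) => //.
- by move=> i h k; rewrite mvecD.
- by move=> i h hH; apply/co_ge0/asg_cone_mvec.
move=> h hH h0; have [c [k [cI kH hE]]] := irreducible_summand hH h0.
have [cH _ _] := cI.
exists c, k; split=> //.
have [s1|s1] := leP 1 (\sum_i co i (mvec F c)); [by left|right=> i].
have om : omega F H c.
  apply: contrapT => nom; move: s1; rewrite ltNge => /negP; apply.
  exact: slimH exta (irreducible_hilbert_basis H) c _ cI nom (coE _).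
have := He (i, c); rewrite normr1 mulr1 => He'; apply/ltW/He'.
rewrite mem_filter (omega_co c).1 //=; apply/allpairsP; exists (i, c) => /=.
by rewrite mem_enum gsP.
Qed.

End Frame.

(** * Coefficients of a polynomial from bounds on its values *)

Section PolynomialGrowth.
Implicit Types P Q : {poly rat}.

(** The uniform bound [e], rather than mere positivity, is what carries the induction through
    multiplication by the variable. *)
Lemma lead_coef_gt0_eventually Q : 0 < lead_coef Q ->
  exists n0 e, 0 < e /\ forall n, (n0 <= n)%N -> e <= Q.[n%:R].
Proof.
elim/poly_ind: Q => [|Q c IH]; first by rewrite lead_coef0 ltxx.
have [->|Q0] := eqVneq Q 0.
  rewrite mul0r add0r lead_coefC => c0; exists 0%N, c; split=> // n _.
  by rewrite hornerC.
have -> : lead_coef (Q * 'X + c%:P) = lead_coef Q.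
  rewrite lead_coefDl ?lead_coefMX // size_mulX //.
  by apply: leq_ltn_trans (size_polyC_leq1 _) _; rewrite ltnS lt0n size_poly_eq0.
move=> /IH[n0 [e [e0 He]]].
(* From [m] on, [e * n] is at least [e + |c|], which absorbs the constant term. *)
pose m := (Num.bound (1 + `|c| / e)).
exists (maxn n0 m), e; split=> // n; rewrite geq_max => /andP[/He nn0 nm].
rewrite hornerMXaddC.
have mn : 1 + `|c| / e <= n%:R :> rat.
  apply: le_trans (_ : m%:R <= _); last by rewrite ler_nat.
  by apply/ltW/le_lt_trans/archi_boundP; rewrite ?lexx // addr_ge0 // divr_ge0 // ltW.
have en : e + `|c| <= Q.[n%:R] * n%:R.
  apply: le_trans (_ : e * n%:R <= _); last by rewrite ler_wpM2r.
  rewrite -(ler_pM2l e0) in mn; apply: le_trans mn.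
  by rewrite mulrDr mulr1 mulrCA divff ?gt_eqF // mulr1.
have := ler_norm (- c); rewrite normrN; lra.
Qed.

Lemma lead_coef_eventually_ge0 Q n0 :
  (forall n, (n0 <= n)%N -> 0 <= Q.[n%:R]) -> 0 <= lead_coef Q.
Proof.
move=> Q0; rewrite leNgt -oppr_gt0 -lead_coefN; apply/negP.
move=> /lead_coef_gt0_eventually[n1 [e [e0 He]]].
have := He _ (leq_maxr n0 n1); have := Q0 _ (leq_maxl n0 n1).
rewrite hornerN; lra.
Qed.

Lemma polynomial_growth P k n0 (A B C : rat) :
  (forall n, (n0 <= n)%N -> A * (n%:R - C) ^+ k <= k`!%:R * P.[n%:R]) ->
  (forall n, (n0 <= n)%N -> P.[n%:R] <= B * n.+1%:R ^+ k) ->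
  (size P <= k.+1)%N /\ A <= k`!%:R * P`_k.
Proof.
move=> lo hi; have k0 : 0 < k`!%:R :> rat by rewrite ltr0n fact_gt0.
(* By the lower bound [Q] is eventually nonnegative, hence so is its leading coefficient. *)
pose Q := k`!%:R *: P - A *: ('X - C%:P) ^+ k.
have Qlead : 0 <= lead_coef Q.
  apply: (lead_coef_eventually_ge0 (n0 := n0)) => n /lo.
  by rewrite /Q hornerD hornerN !hornerZ horner_exp hornerXsubC subr_ge0.
have szX (D : rat) : (size (('X - D%:P) ^+ k) = k.+1)%N by rewrite size_exp_XsubC.
have szZ (a D : rat) : (size (a *: ('X - D%:P) ^+ k) <= k.+1)%N.
  by rewrite -(szX D); apply: size_scale_leq.
(* In degree above [k], the leading coefficient of [P] would be nonnegative by way of [Q] and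
   nonpositive by the upper bound. *)
have szP : (size P <= k.+1)%N.
  rewrite leqNgt; apply/negP => sP.
  have P0 : lead_coef P != 0.
    by rewrite lead_coef_eq0; apply: contraTneq sP => ->; rewrite size_poly0.
  have lP : 0 <= lead_coef P.
    move: Qlead; rewrite lead_coefDl ?lead_coefZ ?pmulr_rge0 //.
    by rewrite size_polyN (size_scale P (lt0r_neq0 k0)); apply: leq_ltn_trans (szZ _ _) sP.
  have : 0 <= lead_coef (- P + B *: ('X - (-1)%:P) ^+ k).
    apply: (lead_coef_eventually_ge0 (n0 := n0)) => n /hi.
    rewrite hornerD hornerN hornerZ horner_exp hornerXsubC opprK natr1.
    by rewrite [- _ + _]addrC subr_ge0.
  rewrite lead_coefDl ?lead_coefN; last first.
    by rewrite size_polyN; apply: leq_ltn_trans (szZ _ _) sP.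
  by move/eqP: P0; lra.
split=> //; have Qk : Q`_k = k`!%:R * P`_k - A.
  rewrite coefB !coefZ; congr (_ - _).
  have := monicP (monic_exp k (monicXsubC C)).
  by rewrite /lead_coef szX /= => ->; rewrite mulr1.
rewrite -subr_ge0 -Qk leNgt; apply/negP => Qk0.
have szQ : (size Q <= k.+1)%N.
  apply: leq_trans (size_polyD _ _) _; rewrite geq_max size_polyN szZ andbT.
  exact: leq_trans (size_scale_leq _ _) szP.
have kQ : (k < size Q)%N.
  by rewrite ltnNge; apply: contraTN Qk0 => /leq_sizeP -> //; rewrite ltxx.
move: Qlead; rewrite /lead_coef.
have -> : size Q = k.+1 by apply/eqP; rewrite eqn_leq szQ kQ.
by rewrite leNgt Qk0.
Qed.

End PolynomialGrowth.

(** * Module length bounded by the number of generators over the field *)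

Section ChainLength.
Variables (K : fieldType) (R : comNzRingType) (iota : {rmorphism K -> R}).
Variables (V : lmodType R).

Lemma strict_chain_subset (T : Type) (c : nat -> {pred T}) k i j :
  strict_chain c k -> (i <= j <= k)%N -> {subset c i <= c j}.
Proof.
move=> cc; elim: j => [|j IH]; first by case/andP; rewrite leqn0 => /eqP-> x.
case/andP; rewrite leq_eqVlt => /orP[/eqP->|ij] jk x xi //.
by apply: (cc j jk).1; apply: IH xi; rewrite -ltnS ij ltnW.
Qed.

(** Choose a vector in each step of the chain outside the previous member. More than [N] of them
    satisfy a linear relation over [K], and the last one with nonzero coefficient would lie in the
    member that it avoids. *)
Lemma chain_length_le (N k : nat) (g : 'I_N -> V) (c : nat -> submodClosed V) :
  (forall v, exists u : 'I_N -> K, v = \sum_i iota (u i) *: g i) ->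
  strict_chain (fun i => c i : {pred V}) k -> (k <= N)%N.
Proof.
move=> gen cc; rewrite leqNgt; apply/negP => Nk.
have /choice[v Hv] : forall i : 'I_k, exists v, v \in c i.+1 /\ v \notin c i.
  move=> i; apply: contrapT => Hn; apply: (cc i (ltn_ord i)).2 => v vc.
  by apply: contrapT => /negP vn; apply: Hn; exists v.
have /choice[u Hu] := fun i => gen (v i).
pose M : 'M[K]_(k, N) := \matrix_(i, j) u i j.
have [z z0 zM] : exists2 z : 'rV[K]_k, z != 0 & z *m M = 0.
  have: kermx M != 0.
    rewrite kermx_eq0 /row_free neq_ltn; apply/orP; left.
    exact: leq_ltn_trans (rank_leq_col _) Nk.
  move=> /rowV0Pn[z /sub_kermxP zM z0]; by exists z.
have zv : \sum_i iota (z 0 i) *: v i = 0.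
  under eq_bigr => i _ do rewrite Hu scaler_sumr.
  rewrite exchange_big /= big1 // => j _.
  under eq_bigr => i _ do rewrite scalerA -rmorphM.
  rewrite -scaler_suml -rmorph_sum.
  have := congr1 (fun A : 'rV[K]_N => A 0 j) zM; rewrite !mxE => zj.
  rewrite (eq_bigr (fun i => z 0 i * M i j)) ?zj ?rmorph0 ?scale0r // => i _.
  by rewrite mxE.
have [i0 zi0] : exists i, z 0 i != 0.
  apply: contrapT => Hn; case/eqP: z0; apply/rowP => i; rewrite mxE.
  by apply/eqP; apply: contrapT => /negP zi; apply: Hn; exists i.
have [i zi imax] := @arg_maxnP _ i0 (fun i => z 0 i != 0) (fun i => i : nat) zi0.
have [_ /negP[]] := Hv i.
have -> : v i = iota (z 0 i)^-1 *: (iota (z 0 i) *: v i).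
  by rewrite scalerA -rmorphM mulVf // rmorph1 scale1r.
apply: rpredZ; move: zv; rewrite (bigD1 i) //= => /eqP; rewrite addr_eq0 => /eqP->.
rewrite -scaleN1r; apply: rpredZ; apply: rpred_sum => j ji.
have [->|zj] := eqVneq (z 0 j) 0; first by rewrite rmorph0 scale0r rpred0.
apply: rpredZ; apply: (strict_chain_subset cc _ (Hv j).1).
by rewrite (ltnW (ltn_ord i)) andbT ltn_neqAle ji; apply: imax.
Qed.

End ChainLength.

(** * Submodules, and monomials in the semigroup ring and its canonical module *)

Section ClosedPredicate.
Variables (R : comNzRingType) (V : lmodType R).

(** The closure proof is an argument of the term, so that the submodule structure can be inferred
    from it. *)
Definition closed_pred (P : {pred V}) of submod_closed P : {pred V} := P.

HB.instance Definition _ (P : {pred V}) (Pc : submod_closed P) :=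
  GRing.isSubmodClosed.Build R V (closed_pred Pc)
    (GRing.submod_closed_semi Pc).

End ClosedPredicate.

Lemma mcoeffM_neq0 (K : fieldType) d (p q : {mpoly K[d]}) w : (p * q)@_w != 0 ->
  exists h k, [/\ p@_h != 0, q@_k != 0 & w = (h + k)%MM].
Proof.
rewrite -mcoeff_msupp => /msuppM_le/allpairsP[[h k] /= [hp kq ->]].
by exists h, k; rewrite -!mcoeff_msupp.
Qed.

Lemma mcoeffMX_add (K : fieldType) d (p : {mpoly K[d]}) w h :
  (p * 'X_[w])@_(w + h) = p@_h.
Proof. by rewrite mcoeffMX. Qed.

Section SubmoduleValues.
Variables (R : comNzRingType) (V : lmodType R) (N : submodClosed V).
Local Notation W := (submod_type N : lmodType R).

Definition submod_val (x : W) : V := val x.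

Lemma submod_valB (x y : W) : submod_val (x - y) = submod_val x - submod_val y.
Proof. exact: (raddfB val). Qed.

Lemma submod_valZ (a : R) (x : W) : submod_val (a *: x) = a *: submod_val x.
Proof. by []. Qed.

Lemma submod_val_inj : injective submod_val.
Proof. exact: val_inj. Qed.

End SubmoduleValues.

Section SemigroupRingValues.
Variables (K : fieldType) (d : nat) (H : affine_semigroup d).
Local Notation R := (sgring K H).

Definition sgring_val (p : R) : {mpoly K[d]} := val p.

Lemma sgring_val_is_zmod_morphism : zmod_morphism sgring_val.
Proof. exact: (raddfB (val : R -> {mpoly K[d]})). Qed.

Lemma sgring_val_is_monoid_morphism : monoid_morphism sgring_val.
Proof. by split; [exact: rmorph1|exact: rmorphM]. Qed.

Lemma sgring_valZ (c : K) p : sgring_val (c *: p) = c *: sgring_val p.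
Proof. by rewrite /sgring_val linearZ. Qed.

Lemma sgring_valM (p q : R) : sgring_val (p * q) = sgring_val p * sgring_val q.
Proof. exact: sgring_val_is_monoid_morphism.2. Qed.

HB.instance Definition _ := GRing.isZmodMorphism.Build R {mpoly K[d]}
  sgring_val sgring_val_is_zmod_morphism.
HB.instance Definition _ := GRing.isMonoidMorphism.Build R {mpoly K[d]}
  sgring_val sgring_val_is_monoid_morphism.

Lemma sgring_valD (p q : R) : sgring_val (p + q) = sgring_val p + sgring_val q.
Proof. exact: raddfD. Qed.

Lemma sgring_val0 : sgring_val (0 : R) = 0.
Proof. exact: raddf0. Qed.

Lemma sgring_val1 : sgring_val (1 : R) = 1.
Proof. exact: rmorph1. Qed.

End SemigroupRingValues.

Section Monomials.
Variables (F : realType) (K : fieldType) (d : nat) (H : affine_semigroup d).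
Variable S : simplicial_frame F H.
Local Notation R := (sgring K H).
Local Notation omegaR := (canonical_module F K H).
Implicit Types (h k w : 'X_{1..d}) (v : omegaR).

Lemma omega_mem h : omega F H h -> h \in H.
Proof.
move=> /(omega_coord S) hpos; have [|g gH ->] := ray_coord_diff (s := S) (h := h) (k := 0%MM).
  move=> i; apply/ltW/le_lt_trans/hpos.
  by rewrite -(lerD2l (ray_coord S i 0%MM)) -ray_coordD addm0 addr0.
by rewrite add0m.
Qed.

Lemma sgring_supp (p : R) h : (sgring_val p)@_h != 0 -> h \in H.
Proof. by rewrite -mcoeff_msupp; apply: (allP (valP p)). Qed.

(** Total in the exponent, with value 0 outside [H], so that no membership proof enters the term;
    likewise [cmono] below. *)
Definition sgmono h : R := insubd 0 'X_[h].

Lemma val_sgmono h : h \in H -> sgring_val (sgmono h) = 'X_[h].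
Proof.
by move=> hH; rewrite /sgring_val val_insubd unfold_in msuppX /= hH.
Qed.

Definition poly_of (v : omegaR) : {mpoly K[d]} := sgring_val (submod_val v).

Lemma poly_of_is_zmod_morphism : zmod_morphism poly_of.
Proof. by move=> v v'; rewrite /poly_of [submod_val _]submod_valB [LHS]raddfB. Qed.

HB.instance Definition _ := GRing.isZmodMorphism.Build omegaR {mpoly K[d]}
  poly_of poly_of_is_zmod_morphism.

Lemma poly_ofD v v' : poly_of (v + v') = poly_of v + poly_of v'.
Proof. exact: raddfD. Qed.

Lemma poly_ofB v v' : poly_of (v - v') = poly_of v - poly_of v'.
Proof. exact: raddfB. Qed.

Lemma poly_of0 : poly_of 0 = 0.
Proof. exact: raddf0. Qed.

Lemma poly_ofZ (a : R) v : poly_of (a *: v) = sgring_val a * poly_of v.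
Proof. by rewrite /poly_of [submod_val _]submod_valZ [LHS]rmorphM. Qed.

Lemma poly_of_inj : injective poly_of.
Proof.
move=> v v' /val_inj.
exact: (@submod_val_inj _ _ (omega_pred F (H := H) : submodClosed R^o)).
Qed.

Lemma poly_of_supp v w : (poly_of v)@_w != 0 -> omega F H w.
Proof. by rewrite -mcoeff_msupp => wv; apply/asboolP/(allP (valP v)). Qed.

Definition cmono w : omegaR := insubd 0 (sgmono w : R^o).

Lemma poly_of_cmono w : omega F H w -> poly_of (cmono w) = 'X_[w].
Proof.
move=> ww; rewrite /poly_of /submod_val val_insubd unfold_in.
have E := val_sgmono (omega_mem ww); rewrite /sgring_val in E.
by rewrite E msuppX /= asboolT //= -[RHS]E.
Qed.

Lemma cmonoD h w : h \in H -> omega F H w -> cmono (h + w)%MM = sgmono h *: cmono w.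
Proof.
move=> hH ww; apply: poly_of_inj; rewrite poly_ofZ val_sgmono // !poly_of_cmono //.
  by rewrite mpolyXD.
exact: omegaD.
Qed.

(** The structure map through which modules over the semigroup ring are vector spaces over [K]. *)
Definition const (c : K) : R := c%:A.

Lemma const_is_zmod_morphism : zmod_morphism const.
Proof. by move=> x y; rewrite /const scalerBl. Qed.

Lemma const_is_monoid_morphism : monoid_morphism const.
Proof. by split=> [|x y]; rewrite /const ?scale1r // -scalerAl mul1r scalerA. Qed.

HB.instance Definition _ := GRing.isZmodMorphism.Build K R const
  const_is_zmod_morphism.
HB.instance Definition _ := GRing.isMonoidMorphism.Build K R const
  const_is_monoid_morphism.

Lemma val_const c : sgring_val (const c) = c%:MP.
Proof. by rewrite /const sgring_valZ rmorph1 -mul_mpolyC mulr1. Qed.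

Lemma cmono_expansion v :
  v = \sum_(w <- msupp (poly_of v)) const (poly_of v)@_w *: cmono w.
Proof.
apply: poly_of_inj; rewrite raddf_sum {1}[poly_of v]mpolyE.
apply: eq_big_seq => w wv; rewrite [RHS]poly_ofZ val_const mul_mpolyC.
by rewrite poly_of_cmono //; apply: (poly_of_supp (v := v)); rewrite -mcoeff_msupp.
Qed.

End Monomials.

Section SpanInduction.
Variables (R : comNzRingType) (V : lmodType R).

Lemma submod_span_ind (S P : V -> Prop) :
  P 0 -> (forall x y, P x -> P y -> P (x + y)) -> (forall a x, S x -> P (a *: x)) ->
  forall v, v \in submod_span S -> P v.
Proof.
move=> P0 PD PS v /asboolP[s [Ss ->]].
elim: s Ss => [|y s IH] Ss; first by rewrite big_nil.
rewrite big_cons; apply: PD; first exact/PS/Ss/mem_head.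
by apply: IH => z zs; apply: Ss; rewrite inE zs orbT.
Qed.

Lemma submod_span_gen (S : V -> Prop) v : S v -> v \in submod_span S.
Proof.
move=> Sv; apply/asboolP; exists [:: (1, v)]; rewrite big_seq1 scale1r.
by split=> // x; rewrite inE => /eqP->.
Qed.

Variable N : submodClosed V.

Lemma quotmod_surj (y : quotmod N) : exists v, y = quotmod_proj N v.
Proof. by exists (repr y); rewrite quotmod_projK. Qed.

Lemma quotmod_proj_eq0 v : quotmod_proj N v = 0 <-> v \in N.
Proof.
rewrite -[v in v \in N]subr0; split=> [v0|/quotmod_projP ->].
  by apply/quotmod_projP; rewrite v0 raddf0.
by rewrite raddf0.
Qed.

End SpanInduction.

(** * Powers of the graded maximal ideal *)

Section Order.
Variables (d : nat) (H : affine_semigroup d).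
Implicit Types (h k c w : 'X_{1..d}).

(* The exponents of the monomials in the m-th power of the maximal ideal. *)
Fixpoint order_ge (m : nat) h : Prop :=
  if m is m'.+1
  then exists c k, [/\ c \in H, c != 0%MM, order_ge m' k & h = (c + k)%MM]
  else h \in H.

Lemma order_geDl m h k : h \in H -> order_ge m k -> order_ge m (h + k)%MM.
Proof.
move=> hH; elim: m k => [|m IH] k /=; first exact: asgD.
move=> [c [l [cH c0 lo ->]]]; exists c, (h + l)%MM; split=> //; first exact: IH.
by rewrite !addmA [(h + c)%MM]addmC.
Qed.

Lemma order_ge_mem m h : order_ge m h -> h \in H.
Proof.
elim: m h => [|m IH] h //= [c [k [cH _ /IH kH ->]]]; exact: asgD.
Qed.

Lemma order_geD m n h k : order_ge m h -> order_ge n k -> order_ge (m + n) (h + k)%MM.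
Proof.
elim: m h => [|m IH] h /=; first exact: order_geDl.
move=> [c [l [cH c0 lo ->]]] ko; exists c, (l + k)%MM; split=> //; first exact: IH.
by rewrite addmA.
Qed.

Lemma order_ge_leq m n h : (m <= n)%N -> order_ge n h -> order_ge m h.
Proof.
elim: m n h => [|m IH] n h; first by move=> _ /order_ge_mem.
case: n => // n mn [c [k [cH c0 ko ->]]].
by exists c, k; split=> //; apply: IH ko.
Qed.

Lemma order_geMn h m : h \in H -> h != 0%MM -> order_ge m (h *+ m)%MM.
Proof.
move=> hH h0; elim: m => [|m IH]; first exact: asg0.
by rewrite mulmS; exists h, (h *+ m)%MM.
Qed.

End Order.

Section IdealPowers.
Variables (K : fieldType) (d : nat) (H : affine_semigroup d).
Local Notation R := (sgring K H).
Local Notation I := (@sgring_max_ideal K d H).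
Implicit Types (h k : 'X_{1..d}).

Lemma sgring_max_ideal_order (p : R) h :
  p \in I -> (sgring_val p)@_h != 0 -> order_ge H 1 h.
Proof.
move=> pI; move: h; move: p pI.
apply: (submod_span_ind (P := fun p : R^o =>
  forall h, (sgring_val p)@_h != 0 -> order_ge H 1 h)).
- by move=> h; rewrite sgring_val0 mcoeff0 eqxx.
- move=> x y Hx Hy h; rewrite sgring_valD mcoeffD => xy.
  have [x0|x0] := eqVneq ((sgring_val x)@_h) 0; last exact: Hx.
  by apply: Hy; move: xy; rewrite x0 add0r.
move=> a x [k [kH k0 xE]] h; rewrite sgring_valM.
move=> /mcoeffM_neq0[l [m [/sgring_supp lH]]].
have -> : sgring_val x = 'X_[k] by exact: xE.
rewrite mcoeffX; have [<- _ ->|_] := eqVneq k m; last by rewrite eqxx.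
by apply: order_geDl => //; exists k, 0%MM; rewrite addm0; split=> //; apply: asg0.
Qed.

(** Together with [sgmono_ideal_pow] this shows that the powers are spanned by the monomials they
    contain. *)
Lemma ideal_pow_order m (p : R) h :
  p \in ideal_pow I m -> (sgring_val p)@_h != 0 -> order_ge H m h.
Proof.
elim: m p h => [|m IH] p h; first by move=> _ /sgring_supp.
move=> pI; move: h; move: p pI.
apply: (submod_span_ind (P := fun p : R^o =>
  forall h, (sgring_val p)@_h != 0 -> order_ge H m.+1 h)).
- by move=> h; rewrite sgring_val0 mcoeff0 eqxx.
- move=> x y Hx Hy h; rewrite sgring_valD mcoeffD => xy.
  have [x0|x0] := eqVneq ((sgring_val x)@_h) 0; last exact: Hx.
  by apply: Hy; move: xy; rewrite x0 add0r.
move=> a x [q [r [qI rI ->]]] h; rewrite sgring_valM.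
move=> /mcoeffM_neq0[l [n [/sgring_supp lH]]].
rewrite sgring_valM => /mcoeffM_neq0[k [k' [qk rk ->]] ->].
apply: order_geDl => //; rewrite -add1n; apply: order_geD (IH _ _ rI rk).
exact: sgring_max_ideal_order qI qk.
Qed.

Lemma sgmono_ideal_pow m h : order_ge H m h -> sgmono K H h \in ideal_pow I m.
Proof.
elim: m h => [|m IH] h //= [c [k [cH c0 ko ->]]].
apply: submod_span_gen; exists (sgmono K H c), (sgmono K H k); split=> //.
- by apply: submod_span_gen; exists c; split=> //; apply: val_sgmono.
- exact: IH.
apply: val_inj; rewrite -![val _]/(sgring_val _) [RHS]sgring_valM.
have kH := order_ge_mem ko.
by rewrite !val_sgmono ?asgD // mpolyXD.
Qed.

End IdealPowers.

(** * Lengths of the quotients of E by powers of the maximal ideal, in terms of monomials *)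

Section HilbertSamuel.
Variables (F : realType) (K : fieldType) (d : nat) (H : affine_semigroup d).
Variables (S : simplicial_frame F H) (b : 'X_{1..d}).
Local Notation R := (sgring K H).
Local Notation omegaR := (canonical_module F K H).
Local Notation I := (@sgring_max_ideal K d H).
Local Notation E := (omega_quotient F K H b).
Implicit Types (h k w : 'X_{1..d}) (v : omegaR).

Definition ecls (v : omegaR) : E :=
  quotmod_proj (@monomial_submod F K d H b : submodClosed omegaR) v.

Lemma eclsB v v' : ecls (v - v') = ecls v - ecls v'.
Proof. exact: (raddfB (quotmod_proj (@monomial_submod F K d H b : submodClosed omegaR))). Qed.

Lemma ecls_is_zmod_morphism : zmod_morphism ecls.
Proof. exact: eclsB. Qed.

HB.instance Definition _ := GRing.isZmodMorphism.Build omegaR E ecls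
  ecls_is_zmod_morphism.

Lemma eclsZ a v : ecls (a *: v) = a *: ecls v.
Proof. exact: quotmod_proj_scalable. Qed.

Lemma ecls_surj (y : E) : exists v, y = ecls v.
Proof. exact: quotmod_surj. Qed.

Lemma ecls_eq0 v : ecls v = 0 <-> v \in @monomial_submod F K d H b.
Proof. exact: quotmod_proj_eq0. Qed.

Definition outside w := forall h, h \in H -> w <> (h + b)%MM.

Lemma ecls_eq0_coef v w : ecls v = 0 -> outside w -> (poly_of v)@_w = 0.
Proof.
move=> /ecls_eq0 vb wo; apply/eqP; apply: contrapT => /negP.
move: v vb; apply: (submod_span_ind (P := fun v : omegaR => (poly_of v)@_w != 0 -> False)).
- by rewrite poly_of0 mcoeff0 eqxx.
- move=> x y Hx Hy; rewrite poly_ofD mcoeffD => xy.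
  have [x0|x0] := eqVneq ((poly_of x)@_w) 0; last exact: Hx.
  by apply: Hy; move: xy; rewrite x0 add0r.
move=> a x xb; rewrite poly_ofZ => /mcoeffM_neq0[h [k [/sgring_supp hH]]].
have -> : poly_of x = 'X_[b] by exact: xb.
rewrite mcoeffX; have [<- _|_] := eqVneq b k; last by rewrite eqxx.
exact: wo.
Qed.

Lemma ecls_cmono_eq0 h : omega F H b -> h \in H ->
  ecls (cmono F K H (h + b)) = 0.
Proof.
move=> bo hH; rewrite (cmonoD K S) // eclsZ.
have -> : ecls (cmono F K H b) = 0; last by rewrite scaler0.
by apply/ecls_eq0/submod_span_gen; apply: (poly_of_cmono K S).
Qed.

Local Notation V n := (mod_modulo E I n.+1).

Definition vcls n v : V n :=
  quotmod_proj (smulmod (ideal_pow I n.+1) predT : submodClosed E) (ecls v).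

Lemma vclsB n v v' : vcls n (v - v') = vcls n v - vcls n v'.
Proof. by rewrite /vcls eclsB [LHS]raddfB. Qed.

Lemma vclsZ n a v : vcls n (a *: v) = a *: vcls n v.
Proof. by rewrite /vcls eclsZ [LHS]quotmod_proj_scalable. Qed.

Lemma vcls_is_zmod_morphism n : zmod_morphism (vcls n).
Proof. exact: vclsB. Qed.

HB.instance Definition _ n :=
  GRing.isZmodMorphism.Build omegaR (V n) (vcls n) (vcls_is_zmod_morphism n).

Lemma vcls_surj n (x : V n) : exists v, x = vcls n v.
Proof.
have [y ->] := quotmod_surj x; have [v ->] := ecls_surj y; by exists v.
Qed.

(** Only some representative can be controlled, since classes in E are already taken modulo x^b
    R. *)
Lemma smulmod_ecls m (y : E) : y \in smulmod (ideal_pow I m) (predT : {pred E}) ->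
  exists v, y = ecls v /\ forall w, (poly_of v)@_w != 0 ->
    exists h k, [/\ order_ge H m h, omega F H k & w = (h + k)%MM].
Proof.
move: y; apply: submod_span_ind.
- exists 0; split=> [|w]; last by rewrite poly_of0 mcoeff0 eqxx.
  by rewrite [RHS]raddf0.
- move=> x y [u [-> Hu]] [v [-> Hv]]; exists (u + v); split=> [|w].
    by rewrite [RHS]raddfD.
  rewrite poly_ofD mcoeffD => xy.
  have [x0|x0] := eqVneq ((poly_of u)@_w) 0; last exact: Hu.
  by apply: Hv; move: xy; rewrite x0 add0r.
move=> a x [p [y [pI _ ->]]]; have [v ->] := ecls_surj y.
exists (a *: (p *: v)); split=> [|w]; first by rewrite !eclsZ.
rewrite !poly_ofZ => /mcoeffM_neq0[h [k [/sgring_supp hH]]].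
move=> /mcoeffM_neq0[l [m' [/(ideal_pow_order pI) lo /poly_of_supp mo ->]] ->].
exists (h + l)%MM, m'; split=> //; first exact: order_geDl.
by rewrite addmA.
Qed.

Lemma vcls_eq0_coef n v w : vcls n v = 0 -> outside w ->
  (forall h k, order_ge H n.+1 h -> omega F H k -> w <> (h + k)%MM) ->
  (poly_of v)@_w = 0.
Proof.
move=> /quotmod_proj_eq0/smulmod_ecls[u [vu Hu]] wo wn.
have u0 : (poly_of u)@_w = 0.
  by apply/eqP; apply: contrapT => /negP /Hu[h [k [ho ko]]]; apply: wn.
have /ecls_eq0_coef /(_ wo) : ecls (v - u) = 0 by rewrite eclsB vu subrr.
by rewrite poly_ofB mcoeffB u0 subr0.
Qed.

Lemma vcls_cmono_eq0 n h k : order_ge H n.+1 h -> omega F H k ->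
  vcls n (cmono F K H (h + k)) = 0.
Proof.
move=> ho ko; rewrite (cmonoD K S) ?(order_ge_mem ho) //.
apply/quotmod_proj_eq0; rewrite eclsZ; apply: submod_span_gen.
exists (sgmono K H h), (ecls (cmono F K H k)); split=> //.
exact: sgmono_ideal_pow.
Qed.

(** By [vcls_eq0_coef], distinct such exponents give monomials whose classes in [V n] are linearly
    independent over [K]. *)
Definition survives n w := [/\ omega F H w, outside w
  & forall h k, order_ge H n.+1 h -> omega F H k -> w <> (h + k)%MM].

Section Chain.
Variables (n : nat) (s : seq 'X_{1..d}).

(** Vanishing of the coefficients at the exponents of [s] from index [i] on would not be stable
    under multiplication by the ring, so it is required at every exponent dividing one of them. *)
Definition chain_pred i : {pred V n} := fun x => `[< exists v, x = vcls n v /\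
  forall j w h, (i <= j < size s)%N -> h \in H -> omega F H w ->
    nth 0%MM s j = (w + h)%MM -> (poly_of v)@_w = 0 >].

Lemma chain_pred_closed i : submod_closed (chain_pred i).
Proof.
split=> [|a x y /asboolP[u [-> Hu]] /asboolP[v [-> Hv]]]; apply/asboolP.
  exists 0; split=> [|j w h _ _ _ _]; first by rewrite [RHS]raddf0.
  by rewrite poly_of0 mcoeff0.
exists (a *: u + v); split=> [|j w h ij hH wo sj].
  by rewrite [RHS]raddfD; congr (_ + _); apply/esym/vclsZ.
rewrite poly_ofD mcoeffD (Hv j w h) // addr0 poly_ofZ.
apply/eqP; apply: contrapT => /negP /mcoeffM_neq0[k [l [/sgring_supp kH ul wE]]].
have lo := poly_of_supp ul; case/eqP: ul.
apply: (Hu j l (k + h)%MM) => //; first exact: asgD.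
by rewrite sj wE [(k + l)%MM]addmC addmA.
Qed.

Definition chain i : submodClosed (V n) := closed_pred (chain_pred_closed i).

(** In decreasing degree no later exponent is a multiple of the one at [i], whose monomial therefore
    lies in member [i.+1]. It is not in member [i], because that exponent survives. *)
Lemma chain_strict : uniq s -> sorted (fun w k => mdeg k <= mdeg w)%N s ->
  (forall w, w \in s -> survives n w) ->
  strict_chain (fun i => chain i : {pred V n}) (size s).
Proof.
move=> us ss Hs i isz; split=> [x /asboolP[v [-> Hv]]|sub].
  apply/asboolP; exists v; split=> // j w h /andP[ij js]; apply: Hv.
  by rewrite ltnW.
have [wo out ord] := Hs _ (mem_nth 0%MM isz).
pose w := nth 0%MM s i.
have: vcls n (cmono F K H w) \in chain i.+1.
  apply/asboolP; exists (cmono F K H w); split=> // j u h /andP[ij js] hH uo uE.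
  rewrite (poly_of_cmono K S) // mcoeffX; have [wu|//] := eqVneq w u.
  have dge : (mdeg (nth 0%MM s j) <= mdeg w)%N.
    apply: (sorted_leq_nth _ _ 0%MM ss) => //; rewrite ?inE //; last exact: ltnW.
    by move=> x y z xy yz; apply: leq_trans yz xy.
  have h0 : h = 0%MM.
    by apply/eqP; rewrite -mdeg_eq0; move: dge; rewrite uE mdegD wu; lia.
  move: uE; rewrite h0 addm0 -wu => /eqP; rewrite nth_uniq // => /eqP ji.
  by rewrite ji ltnn in ij.
move=> /sub /asboolP[v [/eqP + Hv]]; rewrite -subr_eq0 -vclsB => /eqP.
move=> /vcls_eq0_coef /(_ out ord); rewrite poly_ofB mcoeffB.
rewrite (poly_of_cmono K S) // mcoeffX eqxx (Hv i w 0%MM) ?leqnn ?asg0 ?addm0 //.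
by rewrite subr0 => /eqP; rewrite oner_eq0.
Qed.

End Chain.

Lemma mod_length_ge n l (s : seq 'X_{1..d}) : uniq s ->
  (forall w, w \in s -> survives n w) -> mod_length (V n) l -> (size s <= l)%N.
Proof.
move=> us Hs [_ lmax]; pose t := sort (fun w k : 'X_{1..d} => mdeg k <= mdeg w)%N s.
rewrite -(size_sort (fun w k : 'X_{1..d} => mdeg k <= mdeg w)%N s) -/t; apply: lmax.
exists (chain n t); apply: chain_strict; rewrite ?sort_uniq //.
  by apply: sort_sorted => x y; apply: leq_total.
by move=> w; rewrite mem_sort; apply: Hs.
Qed.

(** The monomials with exponent in [s] span [V n] over [K], so [chain_length_le] applies. *)
Lemma mod_length_le n l (s : seq 'X_{1..d}) :
  (forall w, omega F H w -> w \notin s -> vcls n (cmono F K H w) = 0) ->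
  mod_length (V n) l -> (l <= size s)%N.
Proof.
move=> Hs [[c cc] _].
apply: (@chain_length_le _ _ (@const K d H) _ _ _
  (fun i : 'I_(size s) => vcls n (cmono F K H (nth 0%MM s i))) c _ cc) => x.
have [v ->] := vcls_surj x; rewrite (cmono_expansion S v) raddf_sum big_seq.
apply: (big_ind (fun y : V n => exists u : 'I_(size s) -> K, y = _)) => [|y z|w wv].
- by exists (fun=> 0); rewrite big1 // => i _; rewrite rmorph0 scale0r.
- move=> [u ->] [u' ->]; exists (fun i => u i + u' i); rewrite -big_split /=.
  by apply: eq_bigr => i _; rewrite rmorphD scalerDl.
have wo : omega F H w by apply: (poly_of_supp (v := v)); rewrite -mcoeff_msupp.
have [ws|/(Hs _ wo) w0] := boolP (w \in s); last first.
  exists (fun=> 0); rewrite big1 => [|i _]; last by rewrite rmorph0 scale0r.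
  by rewrite [LHS]vclsZ w0 scaler0.
have iw : (index w s < size s)%N by rewrite index_mem.
exists (fun i => if i == Ordinal iw then (poly_of v)@_w else 0).
rewrite (bigD1 (Ordinal iw)) //= eqxx nth_index // big1 => [|i /negPf->].
  by rewrite addr0 [LHS]vclsZ.
by rewrite rmorph0 scale0r.
Qed.

End HilbertSamuel.

(** * Prime ideals attached to the faces of the cone *)

Section FaceIdeals.
Variables (F : realType) (K : fieldType) (d : nat) (H : affine_semigroup d).
Variables (S : simplicial_frame F H) (A : pred 'I_d).
Local Notation R := (sgring K H).
Implicit Types (h k w : 'X_{1..d}).

Definition on_face h := [forall i, A i ==> (ray_coord S i h == 0)].

Lemma on_face0 : on_face 0%MM.
Proof.
apply/forallP => i; apply/implyP => _; have := ray_coordD S i 0%MM 0%MM.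
by rewrite addm0 => /eqP; rewrite -subr_eq0 opprD addrA subrr add0r oppr_eq0.
Qed.

Lemma on_faceD h k : h \in H -> k \in H -> on_face (h + k)%MM = on_face h && on_face k.
Proof.
move=> hH kH; apply/forallP/andP => [hk|[/forallP hf /forallP kf] i].
  split; apply/forallP => i; apply/implyP => Ai; have /implyP/(_ Ai) := hk i;
    by rewrite ray_coordD paddr_eq0 ?ray_coord_ge0 // => /andP[].
apply/implyP => Ai; rewrite ray_coordD.
have /implyP/(_ Ai)/eqP-> := hf i; have /implyP/(_ Ai)/eqP-> := kf i.
by rewrite addr0.
Qed.

Definition face_part (p : {mpoly K[d]}) : {mpoly K[d]} :=
  \sum_(h <- msupp p | on_face h) p@_h *: 'X_[h].

Lemma mcoeff_face_part (p : {mpoly K[d]}) w :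
  (face_part p)@_w = if on_face w then p@_w else 0.
Proof.
rewrite /face_part raddf_sum /= -big_filter.
have [/andP[wf wp]|nw] := boolP (on_face w && (w \in msupp p)).
  rewrite wf (bigD1_seq w) ?filter_uniq ?msupp_uniq ?mem_filter ?wf //=.
  rewrite mcoeffZ mcoeffX eqxx mulr1 big1 ?addr0 // => h hw.
  by rewrite mcoeffZ mcoeffX (negPf hw) mulr0.
rewrite big_seq big1 => [|h]; last first.
  rewrite mem_filter mcoeffZ mcoeffX => hp; have [hw|_] := eqVneq h w.
    by move: nw; rewrite -hw hp.
  by rewrite mulr0.
by case: ifP nw => //= _; rewrite mcoeff_msupp negbK => /eqP.
Qed.

Definition face_ideal : {pred R} := fun p : R => all (fun h => ~~ on_face h) (msupp (sgring_val p)).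

Lemma face_idealP (p : R) :
  reflect (forall h, on_face h -> (sgring_val p)@_h = 0) (p \in face_ideal).
Proof.
apply: (iffP allP) => [pf h hf|pf h].
  by apply/eqP; rewrite mcoeff_eq0; apply/negP => /pf; rewrite hf.
by rewrite mcoeff_msupp; apply: contra => /pf ->.
Qed.

Lemma face_ideal_closed : idealr_closed face_ideal.
Proof.
split.
- by apply/face_idealP => h _; rewrite sgring_val0 mcoeff0.
- apply/face_idealP => /(_ 0%MM on_face0); rewrite sgring_val1.
  by rewrite mcoeff1 eqxx => /eqP; rewrite oner_eq0.
move=> a u v /face_idealP uf /face_idealP vf; apply/face_idealP => h hf.
rewrite sgring_valD mcoeffD [X in _ + X]vf // addr0.
apply/eqP; apply: contrapT; rewrite sgring_valM => /negP.
move=> /mcoeffM_neq0[k [l [/sgring_supp kH ul hE]]].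
move: hf; rewrite hE on_faceD ?(sgring_supp ul) // => /andP[_ lf].
by move: ul; rewrite uf ?eqxx.
Qed.

(** On the semigroup ring, [face_part] is multiplicative with kernel [face_ideal], and its values
    lie in a polynomial ring, which is a domain. *)
Lemma face_ideal_prime : prime_idealr_closed face_ideal.
Proof.
move=> u v uv; apply/negPn; rewrite negb_or; apply/negP => /andP[un vn].
have nz (p : R) : p \notin face_ideal -> face_part (sgring_val p) != 0.
  apply: contraNneq => p0; apply/face_idealP => h hf.
  by have := mcoeff_face_part (sgring_val p) h; rewrite hf p0 mcoeff0.
have uv0 : face_part (sgring_val u) * face_part (sgring_val v) != 0.
  by rewrite mulf_neq0 ?nz.
have [w cw] : exists w, (face_part (sgring_val u) * face_part (sgring_val v))@_w != 0.
  apply: contrapT => Hn; case/eqP: uv0; apply/mpolyP => w; rewrite mcoeff0.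
  by apply/eqP; apply: contrapT => /negP ?; apply: Hn; exists w.
have wf : on_face w.
  have := cw => /mcoeffM_neq0[h [k [hu kv ->]]].
  move: hu kv; rewrite !mcoeff_face_part; case: ifP => [hf hu|]; rewrite ?eqxx //.
  case: ifP => [kf kv|]; rewrite ?eqxx //.
  by rewrite on_faceD ?hf ?(sgring_supp hu) ?(sgring_supp kv).
(* Summands in [H] of an exponent on the face are on the face, so only the face parts contribute at
   [w]. *)
have cE : (sgring_val u * sgring_val v)@_w
    = (face_part (sgring_val u) * face_part (sgring_val v))@_w.
  have E (p : R) : sgring_val p = face_part (sgring_val p) + (sgring_val p - face_part (sgring_val p)).
    by rewrite addrC subrK.
  have off (p q : R) (q' : {mpoly K[d]}) : (forall h, q'@_h != 0 -> h \in H) ->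
      ((sgring_val p - face_part (sgring_val p)) * q')@_w = 0.
    move=> q'H; apply/eqP; apply: contrapT => /negP /mcoeffM_neq0[h [k [hp kq wE]]].
    move: hp; rewrite mcoeffB mcoeff_face_part; case: ifP => hf; first by rewrite subrr eqxx.
    rewrite subr0 => /sgring_supp hH.
    by move: wf; rewrite wE on_faceD ?hf // q'H.
  have fpH (p : R) h : (face_part (sgring_val p))@_h != 0 -> h \in H.
    by rewrite mcoeff_face_part; case: ifP => [_ /sgring_supp|]; rewrite ?eqxx.
  rewrite {1}(E u) mulrDl mcoeffD (off u u) => [|h]; last exact: sgring_supp.
  rewrite {1}(E v) mulrDr mcoeffD [face_part _ * (_ - _)]mulrC (off v v) => [|h]; last exact: fpH.
  by rewrite !addr0.
have /face_idealP/(_ w wf) := uv; rewrite sgring_valM cE => /eqP.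
by rewrite (negPf cw).
Qed.

HB.instance Definition _ := isIdealr.Build R face_ideal face_ideal_closed.
HB.instance Definition _ := isPrimeIdealrClosed.Build R face_ideal face_ideal_prime.

End FaceIdeals.

(** * Bounds for the dimension and the number of generators of E *)

Section Invariants.
Variables (F : realType) (K : fieldType) (d : nat) (H : affine_semigroup d).
Variables (S : simplicial_frame F H) (b : 'X_{1..d}).
Local Notation R := (sgring K H).
Local Notation E := (omega_quotient F K H b).
Implicit Types (h k w : 'X_{1..d}).

Lemma outside_coord w j : ray_coord S j w < ray_coord S j b -> outside H b w.
Proof.
move=> wb h hH wE; move: wb; rewrite wE ray_coordD ltNge lerDr.
by rewrite ray_coord_ge0.
Qed.

(* Chain of the face ideals for the faces of the facet opposite to ray j, where
   a whole strip of monomials survives in E. *)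
Lemma krull_dim_ge w j r : omega F H w -> ray_coord S j w < ray_coord S j b ->
  mod_krull_dim E r -> (d.-1 <= r)%N.
Proof.
move=> wo wb [_]; apply.
(* Coordinate [j] vanishes throughout, the other coordinates one after another: the faces shrink and
   their ideals grow. *)
pose A i : pred 'I_d := fun l => if unlift j l is Some s then (s < i)%N else true.
exists (fun i => face_ideal (K := K) S (A i) : prime_idealr R); split=> [i id1|i a _ ann].
  split=> [p /face_idealP pf|sub].
    apply/face_idealP => h /forallP hf; apply: pf; apply/forallP => k.
    apply/implyP => Ak; have /implyP := hf k; apply; move: Ak; rewrite /A.
    by case: unliftP => // s _; apply: ltnW.
  pose k := lift j (Ordinal id1).
  have rv : sgring_val (sgmono K H (ray S k)) = 'X_[ray S k] by rewrite val_sgmono ?ray_mem.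
  have /sub /face_idealP /(_ (ray S k)) : sgmono K H (ray S k) \in face_ideal (K := K) S (A i.+1).
    apply/face_idealP => h /forallP/(_ k)/implyP; rewrite rv mcoeffX.
    have [<-|//] := eqVneq (ray S k) h.
    rewrite /A liftK /= ltnSn ray_coord_ray eqxx => /(_ isT).
    by rewrite oner_eq0.
  rewrite rv mcoeffX eqxx => H1; suff : (1 : K) = 0 by move/eqP; rewrite oner_eq0.
  apply: H1; apply/forallP => l; apply/implyP; rewrite ray_coord_ray /A.
  case: unliftP => [s -> /= si|->]; last by rewrite /k (negPf (neq_lift _ _)).
  rewrite (inj_eq lift_inj) -val_eqE /= ltn_eqF //.
apply/face_idealP => h /forallP/(_ j); rewrite /A unlift_none => /eqP hj.
apply/eqP; apply: contrapT => /negP ah.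
have hH := sgring_supp ah.
(* For [h] on the facet, [w + h] has the same coordinate [j] as [w] and is outside, so the product
   with x^w detects the coefficient of [a] at [h]. *)
have : ecls b (a *: cmono F K H w) = 0 by rewrite eclsZ ann.
move/ecls_eq0_coef => /(_ (w + h)%MM); rewrite poly_ofZ (poly_of_cmono K S) //.
rewrite mcoeffMX_add => a0; case/eqP: ah; apply: a0.
by apply: (outside_coord (j := j)); rewrite ray_coordD hj addr0.
Qed.

Lemma min_gens_le e (s : seq 'X_{1..d}) :
  (forall w, omega F H w -> ecls b (cmono F K H w) = 0 \/
     exists h k, [/\ k \in s, omega F H k, h \in H & w = (h + k)%MM]) ->
  min_gens E e -> (e <= size s)%N.
Proof.
move=> Hs [_]; apply.
exists (fun i : 'I_(size s) => ecls b (cmono F K H (nth 0%MM s i))) => x.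
have [v ->] := ecls_surj x; rewrite (cmono_expansion S v) raddf_sum big_seq.
apply: (big_ind (fun y : E => exists u : 'I_(size s) -> R, y = _)) => [|y z|w wv].
- by exists (fun=> 0); rewrite big1 // => i _; rewrite scale0r.
- move=> [u ->] [u' ->]; exists (fun i => u i + u' i); rewrite -big_split /=.
  by apply: eq_bigr => i _; rewrite scalerDl.
have wo : omega F H w by apply: (poly_of_supp (v := v)); rewrite -mcoeff_msupp.
have [w0|[h [k [ks ko hH ->]]]] := Hs _ wo.
  exists (fun=> 0); rewrite big1 => [|i _]; last by rewrite scale0r.
  by rewrite [LHS]eclsZ w0 scaler0.
have ik : (index k s < size s)%N by rewrite index_mem.
exists (fun i => if i == Ordinal ik then const H (poly_of v)@_(h + k) * sgmono K H h else 0).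
rewrite (bigD1 (Ordinal ik)) //= eqxx nth_index // big1 => [|i /negPf->].
  by rewrite addr0 [LHS]eclsZ (cmonoD K S) // [X in _ *: X]eclsZ scalerA.
by rewrite scale0r.
Qed.

End Invariants.

(** * Interior lattice points modulo the extremal vectors *)

Section Box.
Variables (F : realType) (d : nat) (H : affine_semigroup d).
Variable S : simplicial_frame F H.
Implicit Types (g h k w : 'X_{1..d}) (n : 'I_d -> nat).
Local Notation lam := (ray_coord S).

Lemma ray_coord0 i : lam i 0%MM = 0.
Proof. by apply: (addrI (lam i 0%MM)); rewrite -ray_coordD addm0 addr0. Qed.

Definition ray_sum n : 'X_{1..d} := (\sum_(i < d) ray S i *+ n i)%MM.

Lemma ray_coord_ray_sum j n : lam j (ray_sum n) = (n j)%:R.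
Proof.
have lamMn i m : lam j (ray S i *+ m)%MM = m%:R * (j == i)%:R.
  elim: m => [|m IH]; first by rewrite mulm0n ray_coord0 mul0r.
  by rewrite mulmS ray_coordD IH ray_coord_ray -natr1 mulrDl mul1r addrC.
rewrite /ray_sum (big_morph (lam j) (ray_coordD S j) (ray_coord0 j)).
rewrite (bigD1 j) //= lamMn eqxx mulr1 big1 ?addr0 // => i ij.
by rewrite lamMn eq_sym (negPf ij) mulr0.
Qed.

Lemma ray_neq0 i : ray S i != 0%MM.
Proof.
apply/eqP => r0; have := ray_coord_ray S i i.
by rewrite r0 ray_coord0 eqxx => /eqP; rewrite eq_sym oner_eq0.
Qed.

Lemma ray_sum_order n : order_ge H (\sum_(i < d) n i) (ray_sum n).
Proof.
rewrite /ray_sum; elim: (index_enum _) => [|i s IH].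
  by rewrite !big_nil; apply: asg0.
rewrite !big_cons; apply: order_geD IH; apply: order_geMn; first exact: ray_mem.
exact: ray_neq0.
Qed.

Lemma ray_sum_mem n : ray_sum n \in H.
Proof. exact: order_ge_mem (ray_sum_order n). Qed.

(** While some coordinate exceeds 1, the corresponding ray is subtracted. The point stays in the
    interior, hence the box with coordinates in (0,1], and its degree falls. *)
Lemma box_decomposition w : omega F H w -> exists rho n,
  [/\ omega F H rho, forall i, lam i rho <= 1 & w = (rho + ray_sum n)%MM].
Proof.
have [m] := ubnP (mdeg w); elim: m w => // m IH w wm wo.
have [w1|nw1] := pselect (forall i, lam i w <= 1).
  exists w, (fun=> 0%N); split=> //; rewrite /ray_sum big1 ?addm0 // => i _.
have [i wi] : exists i, 1 < lam i w.
  apply: contrapT => Hn; apply: nw1 => i; rewrite leNgt; apply/negP => wi.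
  by apply: Hn; exists i.
have [|g gH wE] := ray_coord_diff (s := S) (h := w) (k := ray S i).
  move=> j; rewrite ray_coord_ray; have [->|_] := eqVneq j i; first exact: ltW.
  exact/ltW/((omega_coord S w).1 wo).
have go : omega F H g.
  apply/(omega_coord S) => j; have := (omega_coord S w).1 wo j.
  rewrite wE ray_coordD ray_coord_ray; have [->|_] := eqVneq j i.
    by move=> _; move: wi; rewrite wE ray_coordD ray_coord_ray eqxx -[true%:R]/(1 : F) ltrDl.
  by rewrite add0r.
have [|rho [n [ro r1 gE]]] := IH g _ go.
  move: wm; rewrite wE mdegD ltnS; apply: leq_trans.
  by rewrite -add1n leq_add2r lt0n mdeg_eq0 ray_neq0.
exists rho, (fun j => n j + (i == j))%N; split=> //.
rewrite wE gE addmC -addmA; congr (_ + _)%MM.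
rewrite /ray_sum [RHS](eq_bigr (fun j => (ray S j *+ n j) + (ray S j *+ (i == j)))%MM).
  rewrite big_split /=; congr (_ + _)%MM; rewrite (bigD1 i) //= eqxx mulm1n.
  by rewrite big1 ?addm0 // => j ji; rewrite eq_sym (negPf ji).
by move=> j _; apply/mnmP => l; rewrite mnmDE !mulmnE mulnDr.
Qed.

(** The box is finite because each of its points is a summand of the sum of all rays, which bounds
    its degree. *)
Lemma box_enum : exists B : seq 'X_{1..d}, uniq B /\
  forall w, w \in B <-> omega F H w /\ forall i, lam i w <= 1.
Proof.
pose top := ray_sum (fun=> 1%N).
exists [seq w <- [seq val m | m <- enum {: 'X_{1..d < (mdeg top).+1}}]
  | `[< omega F H w /\ forall i, lam i w <= 1 >]]; split.
  by rewrite filter_uniq // map_inj_uniq ?enum_uniq //; apply: val_inj.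
move=> w; rewrite mem_filter; split=> [/andP[/asboolP]//|[wo w1]].
apply/andP; split; first exact/asboolP.
have [|g gH topE] := ray_coord_diff (s := S) (h := top) (k := w).
  by move=> i; rewrite ray_coord_ray_sum.
have wt : (mdeg w < (mdeg top).+1)%N by rewrite topE mdegD ltnS leq_addr.
by apply/mapP; exists (BMultinom wt); rewrite ?mem_enum.
Qed.

Lemma outside_coord_lt b w : outside H b w -> exists j, lam j w < lam j b.
Proof.
move=> out; apply: contrapT => Hn.
have [|g gH wE] := ray_coord_diff (s := S) (h := w) (k := b).
  by move=> j; rewrite leNgt; apply/negP => jw; apply: Hn; exists j.
by apply: (out g gH); rewrite wE addmC.
Qed.

(* Slimness: all but the interior summands contribute at least 1 to the
   coordinate sum, and each interior summand raises every coordinate. *)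
Lemma order_ge_coord m h : order_ge H m h -> exists q, [/\ (q <= m)%N,
  (m - q)%N%:R <= \sum_(i < d) lam i h
  & forall i, q%:R * interior_gap S <= lam i h].
Proof.
elim: m h => [|m IH] h /=.
  move=> hH; exists 0%N; split=> // [|i]; last by rewrite mul0r ray_coord_ge0.
  by apply: sumr_ge0 => i _; apply: ray_coord_ge0.
move=> [c [k [cH c0 /IH[q [qm qs qi]] ->]]].
have [e [g [eH gH -> Hc]]] := slim_summand S cH c0.
have lamE i : lam i (e + g + k)%MM = lam i e + lam i g + lam i k.
  by rewrite !ray_coordD.
have e0 i := ray_coord_ge0 S i eH; have g0 i := ray_coord_ge0 S i gH.
have sumE : \sum_(i < d) lam i (e + g + k)%MM =
    \sum_(i < d) lam i e + \sum_(i < d) lam i g + \sum_(i < d) lam i k.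
  by rewrite -!big_split; apply: eq_bigr => i _; rewrite lamE.
have g0s : 0 <= \sum_(i < d) lam i g by apply: sumr_ge0.
have e0s : 0 <= \sum_(i < d) lam i e by apply: sumr_ge0.
case: Hc => [e1|ei].
  exists q; split=> [||i]; [exact: leqW| |].
    by rewrite sumE subSn // -natr1; lra.
  by rewrite lamE; have := qi i; have := e0 i; have := g0 i; lra.
exists q.+1; split=> [||i] //; first by rewrite sumE subSS; lra.
by rewrite lamE -natr1 mulrDl mul1r; have := qi i; have := ei i; have := g0 i; lra.
Qed.

End Box.

(** * Growth of the Hilbert-Samuel function *)

Section Strips.
Variables (F : realType) (K : fieldType) (d : nat) (H : affine_semigroup d).
Variables (S : simplicial_frame F H) (b : 'X_{1..d}).
Local Notation lam := (ray_coord S).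
Local Notation I := (@sgring_max_ideal K d H).
Local Notation E := (omega_quotient F K H b).
Local Notation V n := (mod_modulo E I n.+1).
Implicit Types (rho w : 'X_{1..d}) (i j : 'I_d).

(** Ray multiplicities along a strip: the lower bound uses [c = 0], the upper bound all [c] below a
    constant. *)
Definition strip j (c : nat) (t : 'I_d.-1 -> nat) i :=
  if unlift j i is Some s then t s else c.

Lemma sum_strip j c t : (\sum_(i < d) strip j c t i = c + \sum_(s < d.-1) t s)%N.
Proof.
rewrite /strip; case: d j t => [[]//|m] j t.
rewrite (bigD1_ord j) //= unlift_none; congr (_ + _)%N.
by apply: eq_bigr => s _; rewrite liftK.
Qed.

Definition in_box rho := omega F H rho /\ forall i, lam i rho <= 1.

Lemma coord_box_sum i rho n : lam i (rho + ray_sum S n)%MM = lam i rho + (n i)%:R.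
Proof. by rewrite ray_coordD ray_coord_ray_sum. Qed.

(** Coordinates of box points lie in (0,1], so two of them differ by less than 1 and the integer
    parts agree. *)
Lemma box_sum_inj i rho rho' (n n' : 'I_d -> nat) : in_box rho -> in_box rho' ->
  (rho + ray_sum S n = rho' + ray_sum S n')%MM -> n i = n' i.
Proof.
move=> [/(omega_coord S)/(_ i) ro /(_ i) r1] [/(omega_coord S)/(_ i) ro' /(_ i) r1'].
move=> /(congr1 (lam i)); rewrite !coord_box_sum => nE.
wlog nn : rho rho' n n' ro r1 ro' r1' nE / (n i <= n' i)%N.
  move=> Hw; case/orP: (leq_total (n i) (n' i)) => nn.
    exact: (Hw rho rho').
  exact/esym/(Hw rho' rho n' n ro' r1' ro r1 (esym nE) nn).
apply/eqP; rewrite eqn_leq nn /= leqNgt; apply/negP => lt.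
have : (n i).+1%:R <= (n' i)%:R :> F by rewrite ler_nat.
by rewrite -natr1; lra.
Qed.

(** With successors as the other multiplicities, [j] is the only index of multiplicity 0 and can be
    read off. This keeps the strips of different pairs disjoint. *)
Lemma strip_box_inj rho rho' j j' (t t' : 'I_d.-1 -> nat) :
  in_box rho -> in_box rho' ->
  (rho + ray_sum S (strip j 0 (fun s => (t s).+1))
    = rho' + ray_sum S (strip j' 0 (fun s => (t' s).+1)))%MM ->
  [/\ rho = rho', j = j' & t =1 t'].
Proof.
move=> ro ro' E; have nE i := box_sum_inj i ro ro' E.
have jj : j = j'.
  have := nE j; rewrite /strip unlift_none; by case: unliftP => [s _|->].
subst j'; split=> //; last first.
  by move=> s; have := nE (lift j s); rewrite /strip liftK => -[].
move: E; rewrite (_ : ray_sum S (strip j 0 _) = ray_sum S (strip j 0 (fun s => (t' s).+1))).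
  exact: addIm.
by apply: eq_bigr => i _; rewrite nE.
Qed.

Lemma survives_strip : exists C, forall n M rho j (t : 'I_d.-1 -> nat),
  in_box rho -> lam j rho < lam j b -> (\sum_(s < d.-1) t s <= M)%N ->
  (M + C <= n)%N ->
  survives F H b n (rho + ray_sum S (strip j 0 (fun s => (t s).+1))).
Proof.
pose gap := interior_gap S; have gap0 : 0 < gap := interior_gap_gt0 S.
(* Coordinate [j] of [w] is below that of [b], so fewer than [N0] summands of [w] can be interior
   ones. *)
pose N0 := Num.bound (\sum_(i < d) `|lam i b| / gap).
have bN0 i : lam i b < N0%:R * gap.
  rewrite -ltr_pdivrMr //; apply: le_lt_trans (archi_boundP _); last first.
    by apply: sumr_ge0 => k _; rewrite divr_ge0 // ltW.
  rewrite (bigD1 i) //= -[X in X <= _]addr0; apply: lerD.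
    by rewrite ler_pM2r ?invr_gt0 // ler_norm.
  by apply: sumr_ge0 => k _; rewrite divr_ge0 // ltW.
(* One [d] bounds the coordinate sum of [rho], the other the [d.-1] successors. *)
exists (N0 + d + d)%N => n M rho j t [ro r1] rb tM MC.
set w := (_ + _)%MM.
have wj : lam j w < lam j b by rewrite coord_box_sum /strip unlift_none addr0.
have ws : \sum_(i < d) lam i w <= (d + (M + d.-1))%N%:R.
  rewrite (eq_bigr _ (fun i _ => coord_box_sum i _ _)) big_split natrD /=.
  apply: lerD.
    apply: le_trans (_ : \sum_(i < d) 1 <= _); first exact: ler_sum.
    by rewrite sumr_const card_ord.
  rewrite -natr_sum ler_nat sum_strip add0n.
  under eq_bigr => s _ do rewrite -addn1.
  by rewrite big_split sum1_card card_ord leq_add2r.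
split.
- by rewrite /w addmC; apply: omegaD => //; apply: ray_sum_mem.
- exact: outside_coord wj.
move=> h k ho ko wE; have kH := omega_mem S ko.
have [q [qn qs qi]] := order_ge_coord S ho.
have hk i : lam i h <= lam i w by rewrite wE ray_coordD lerDl ray_coord_ge0.
have qN : (q < N0)%N.
  rewrite -(ltr_nat F) -(ltr_pM2r gap0).
  by apply: le_lt_trans (qi j) _; apply: le_lt_trans (hk j) _; apply: lt_trans wj _.
have : (n.+1 - q <= d + (M + d.-1))%N.
  rewrite -(ler_nat F); apply: le_trans qs _; apply: le_trans ws.
  exact: ler_sum.
by move: qn qN MC {qs qi}; lia.
Qed.

Lemma length_lower_bound (Q : seq ('X_{1..d} * 'I_d)) : uniq Q ->
  (forall x, x \in Q -> in_box x.1 /\ lam x.2 x.1 < lam x.2 b) ->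
  exists C, forall n M l, (M + C <= n)%N -> mod_length (V n) l ->
    (size Q * 'C(d.-1 + M, d.-1) <= l)%N.
Proof.
move=> uQ HQ; have [C HC] := survives_strip; exists C => n M l Mn.
(* There are ['C(d.-1 + M, d.-1)] such tuples, and each pair of [Q] uses all of them. *)
pose T := enum [set t : d.-1.-tuple 'I_M.+1 | (\sum_(i <- t) i <= M)%N].
pose elt (x : ('X_{1..d} * 'I_d) * d.-1.-tuple 'I_M.+1) : 'X_{1..d} :=
  (x.1.1 + ray_sum S (strip x.1.2 0 (fun s => (tnth x.2 s).+1)))%MM.
pose Z := [seq (x, t) | x <- Q, t <- T].
have <- : size (map elt Z) = (size Q * 'C(d.-1 + M, d.-1))%N.
  by rewrite size_map size_allpairs -cardE card_partial_ord_partitions.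
apply: (mod_length_ge S) => [|w /mapP[[x t] /allpairsP[[x' t'] /= [xQ tT [-> ->]]] ->]].
  rewrite map_inj_in_uniq ?allpairs_uniq ?enum_uniq //; first by case=> ? ? [].
  move=> [x t] [y u] /allpairsP[[x1 t1] /= [xQ _ [-> ->]]] /allpairsP[[y1 u1] /= [yQ _ [-> ->]]].
  have [xb _] := HQ _ xQ; have [yb _] := HQ _ yQ.
  move=> /(strip_box_inj xb yb)[E1 E2 E3]; congr pair.
    by move: E1 E2; case: (x1) (y1) => [? ?] [? ?] /= -> ->.
  by apply: eq_from_tnth => s; apply: val_inj; apply: E3.
have [xb xl] := HQ _ xQ; apply: (HC n M) => //.
by move: tT; rewrite mem_enum inE big_tuple.
Qed.

(** Write an exponent with nonzero class as a box point plus rays. Being outside bounds one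
    multiplicity by a constant, and the others are at most [n], since a sum of more than [n] rays
    has order above [n]. *)
Lemma length_upper_bound : omega F H b -> exists B, forall n l, mod_length (V n) l ->
  (l <= B * n.+1 ^ d.-1)%N.
Proof.
move=> bo; have [Box [uB BP]] := box_enum S.
pose Mb := Num.bound (\sum_(i < d) `|lam i b|).
have bMb i : lam i b < Mb%:R.
  apply: le_lt_trans (archi_boundP _); last by apply: sumr_ge0.
  rewrite (bigD1 i) //= -[X in X <= _]addr0; apply: lerD; first exact: ler_norm.
  exact: sumr_ge0.
exists (size Box * (d * Mb))%N => n l.
pose T := enum {: 'I_d * 'I_Mb * (d.-1).-tuple 'I_n.+1}.
pose elt (x : 'X_{1..d} * ('I_d * 'I_Mb * d.-1.-tuple 'I_n.+1)) : 'X_{1..d} :=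
  (x.1 + ray_sum S (strip x.2.1.1 x.2.1.2 (tnth x.2.2)))%MM.
pose Z := [seq (x, t) | x <- Box, t <- T].
have <- : size (map elt Z) = (size Box * (d * Mb) * n.+1 ^ d.-1)%N.
  rewrite size_map size_allpairs -cardE !card_prod !card_ord card_tuple card_ord.
  by rewrite mulnA.
apply: (mod_length_le S) => w wo; apply: contraNeq => w0.
have [rho [m [ro r1 wE]]] := box_decomposition S wo.
have out : outside H b w.
  move=> h hH wb; case/eqP: w0; rewrite wb /vcls (ecls_cmono_eq0 K S bo hH).
  exact: raddf0.
have [j wj] := outside_coord_lt S out.
have mj : (m j < Mb)%N.
  rewrite -(ltr_nat F); apply: le_lt_trans (bMb j); apply/ltW/le_lt_trans/wj.
  by rewrite wE coord_box_sum lerDr ltW // (omega_coord S _).1.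
have mn : (\sum_(i < d) m i <= n)%N.
  rewrite leqNgt; apply/negP => nm; case/eqP: w0; rewrite wE addmC.
  by apply: (vcls_cmono_eq0 K S) ro; apply: order_ge_leq nm (ray_sum_order S m).
pose t := [tuple inord (m (lift j s)) : 'I_n.+1 | s < d.-1].
apply/mapP; exists (rho, ((j, Ordinal mj), t)).
  by apply/allpairsP; exists (rho, ((j, Ordinal mj), t)); split=> //=;
    [apply/BP|rewrite mem_enum].
rewrite wE /elt /=; congr (_ + _)%MM; apply: eq_bigr => i _; congr (_ *+ _)%MM.
rewrite /strip; case: unliftP => [s ->|-> //]; rewrite tnth_mktuple inordK // ltnS.
by apply: leq_trans mn; rewrite (bigD1 (lift j s)) //= leq_addr.
Qed.

End Strips.

(** * Multiplicity against number of generators *)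

Section Final.
Variables (F : realType) (K : fieldType) (d : nat) (H : affine_semigroup d).
Variables (S : simplicial_frame F H) (b : 'X_{1..d}).
Local Notation lam := (ray_coord S).
Local Notation I := (@sgring_max_ideal K d H).
Local Notation E := (omega_quotient F K H b).
Implicit Types (rho w : 'X_{1..d}) (i j : 'I_d).

(** The right-hand side is the product (M+1)...(M+k). *)
Lemma rising_factorial_bound k M : (M ^ k <= k`! * 'C(k + M, k))%N.
Proof.
rewrite mulnC bin_ffact; elim: k => [|k IH]; first by rewrite expn0 ffactn0.
rewrite expnS addSn ffactSS; apply: leq_mul IH.
by apply: leqW; rewrite leq_addl.
Qed.

(** The strips bound the multiplicity from below by the size of [Q], and the generating monomials
    bound the number of generators from above by that of [s]. The exponent [w0] witnesses that E is
    nonzero. *)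
Lemma ulrich_strip_count (Q : seq ('X_{1..d} * 'I_d)) (s : seq 'X_{1..d}) w0 j0 :
  uniq Q -> (forall x, x \in Q -> in_box S x.1 /\ lam x.2 x.1 < lam x.2 b) ->
  (forall w, omega F H w -> ecls b (cmono F K H w) = 0 \/
     exists h k, [/\ k \in s, omega F H k, h \in H & w = (h + k)%MM]) ->
  omega F H w0 -> lam j0 w0 < lam j0 b -> omega F H b ->
  ulrich I E -> (size Q <= size s)%N.
Proof.
move=> uQ HQ Hs wo wb bo ulr.
have out0 := outside_coord wb.
have nz : ecls b (cmono F K H w0) <> 0.
  move=> /ecls_eq0_coef/(_ out0); rewrite (poly_of_cmono K S) // mcoeffX eqxx.
  by move/eqP; rewrite oner_eq0.
case: ulr => [E0|[_ [e [r [P [rdim [n0 HP] rP]]] egens]]]; first by case: nz.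
have dr := krull_dim_ge wo wb rdim.
have es := min_gens_le S Hs egens.
have [C HC] := length_lower_bound K uQ HQ.
have [B HB] := length_upper_bound K S bo.
have [||szP QP] := @polynomial_growth P d.-1 (n0 + C)%N (size Q)%:R B%:R C%:R.
- move=> n nn; have nC : (C <= n)%N by apply: leq_trans nn; rewrite leq_addl.
  have [l ln ->] := HP n (leq_trans (leq_addr _ _) nn).
  have := HC n (n - C)%N l; rewrite subnK // => /(_ (leqnn _) ln) Ql.
  rewrite -natrB // -natrX -!natrM ler_nat.
  apply: leq_trans (leq_mul (leqnn d.-1`!) Ql); rewrite mulnCA.
  exact: leq_mul (leqnn _) (rising_factorial_bound _ _).
- move=> n nn; have [l ln ->] := HP n (leq_trans (leq_addr _ _) nn).
  by rewrite -natrX -natrM ler_nat; apply: HB ln.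
move: dr; rewrite leq_eqVlt => /orP[/eqP dr|dr].
  by apply: leq_trans es; rewrite -(ler_nat rat) -rP -dr.
(* A dimension above [d.-1] would exceed the degree of [P], making the multiplicity 0; E would then
   need no generators. *)
have e0 : e = 0%N.
  apply/eqP; rewrite -(eqr_nat rat) -rP nth_default ?mulr0 //.
  exact: leq_trans szP dr.
have [[g Hg] _] := egens; case: nz; have [u ->] := Hg (ecls b (cmono F K H w0)).
by apply: big1 => i _; have := ltn_ord i; rewrite [X in (_ < X)%N]e0.
Qed.

End Final.

(** * Uniqueness of the Ulrich element *)

Theorem proposition3p6 (F : realType) (K : fieldType) (d : nat)
  (hd : (2 <= d)%N) (H : affine_semigroup d) (Hslim : slim F H)
  (Hpos : forall h : 'X_{1..d}, h \in H -> h != 0%MM ->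
            forall i : 'I_d, (0 < h i)%N)
  (Hone : omega F H [multinom 1%N | i < d])
  (b : 'X_{1..d}) (Hb : ulrich_element F K H b) :
  b = [multinom 1%N | i < d].
Proof.
have [S] := slim_frame Hslim; have [bo ulr] := Hb.
set one := [multinom 1%N | i < d] in Hone *.
have oneE i : one i = 1%N by rewrite mnmE.
pose i0 := Ordinal (ltnW hd : 0 < d)%N.
have i1 : exists i1 : 'I_d, i1 != i0 by exists (Ordinal hd).
have mem_box := omega_coord S.
have omega_pos w : omega F H w -> forall i, (0 < w i)%N.
  move=> wo; apply: Hpos; first exact: (omega_mem S).
  apply: contraPneq ((mem_box w).1 wo) => -> /(_ i0).
  by rewrite ray_coord0 ltxx.
have lam1 := (mem_box one).1 Hone.
(* As [d >= 2], a ray has a vanishing coordinate, whereas [one] is interior. *)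
have ray_one i : ray S i <> one.
  move=> ri; have [k ki] : exists k : 'I_d, k != i.
    have [k k0] := i1; have [ii|ni] := eqVneq i i0; first by exists k; rewrite ii.
    by exists i0; rewrite eq_sym.
  by have := lam1 k; rewrite -ri ray_coord_ray (negPf ki) ltxx.
(* If coordinate [i] exceeded 1, [w] would be [ray S i] plus a nonzero element. Both have positive
   entries with sum at most 2, so the ray would be [one]. *)
have small_box w : omega F H w -> (forall i, w i <= 2)%N -> in_box S w.
  move=> wo w2; split=> // i; rewrite leNgt; apply/negP => wi.
  have [|g gH wE] := ray_coord_diff (s := S) (h := w) (k := ray S i).
    move=> j; rewrite ray_coord_ray; have [->|_] := eqVneq j i; first exact: ltW.
    exact/ltW/((mem_box w).1 wo).
  have g0 : g != 0%MM.
    by apply: contraTneq wi => g0; rewrite wE g0 addm0 ray_coord_ray eqxx ltxx.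
  apply: (ray_one i); apply/mnmP => k; have := w2 k.
  have := Hpos _ gH g0 k; have := Hpos _ (ray_mem S i) (ray_neq0 S i) k.
  by rewrite wE mnmDE oneE; lia.
pose two := (one + one)%MM.
have one_two : one != two.
  by apply/eqP => /mnmP/(_ i0); rewrite mnmDE oneE.
have two_omega : omega F H two.
  exact: omegaD (omega_mem S Hone) Hone.
have box1 : in_box S one by apply: small_box => // i; rewrite oneE.
have box2 : in_box S two by apply: small_box => // i; rewrite mnmDE oneE.
(* If [w = h + b] with [h] nonzero, both summands have positive entries with sum at most 2, so all
   entries are 1. *)
have out_one w : omega F H w -> (forall i, w i <= 2)%N -> ~ outside H b w ->
    b = w \/ b = one.
  move=> wo w2 nout.
  have [h [hH wE]] : exists h, h \in H /\ w = (h + b)%MM.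
    apply: contrapT => Hn; apply: nout => h hH wE; apply: Hn; by exists h.
  have [h0|h0] := eqVneq h 0%MM; first by left; rewrite wE h0 add0m.
  right; apply/mnmP => k; have := w2 k; have := Hpos _ hH h0 k.
  by have := omega_pos _ bo k; rewrite wE mnmDE oneE; lia.
apply: contrapT => b1.
have out1 : outside H b one.
  by apply: contrapT => /(out_one _ Hone) [] // i; rewrite oneE.
have [Box [uB boxP]] := box_enum S.
have BP w : w \in Box <-> in_box S w := boxP w.
pose Q := [seq x <- [seq (w, j) | w <- Box, j <- enum 'I_d]
  | ray_coord S x.2 x.1 < ray_coord S x.2 b].
pose s := [seq w <- Box | `[< outside H b w >] && (w != two)].
have QP w j : ((w, j) \in Q) <-> in_box S w /\ ray_coord S j w < ray_coord S j b.
  rewrite mem_filter /=; split=> [/andP[wb /allpairsP[[w' j'] /= [wB _ [wE _]]]]|[/BP wB ->]].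
    by split=> //; rewrite wE; apply/BP.
  by rewrite /=; apply/allpairsP; exists (w, j); rewrite mem_enum.
have uQ : uniq Q.
  by rewrite filter_uniq // allpairs_uniq ?enum_uniq // => -[? ?] [? ?].
have sP w : w \in s -> in_box S w /\ outside H b w.
  by rewrite mem_filter => /andP[/andP[/asboolP wo _] /BP wB].
have [j1 j1P] := outside_coord_lt S out1.
have Qs : (size Q <= size s)%N.
  apply: (ulrich_strip_count uQ _ _ Hone j1P bo ulr) => [[w j] /QP //|w wo].
  have [rho [n [ro r1 wE]]] := box_decomposition S wo.
  have [out|] := pselect (outside H b rho); last first.
    move=> nout; left; have [h [hH hE]] : exists h, h \in H /\ rho = (h + b)%MM.
      apply: contrapT => Hn; apply: nout => h hH hE; apply: Hn; by exists h.
    rewrite wE hE addmC addmA; apply: (ecls_cmono_eq0 K S bo).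
    by apply: asgD => //; apply: ray_sum_mem.
  (* The monomial of [two] is a multiple of that of [one], which replaces it as a generator. *)
  right; have [r2|r2] := eqVneq rho two.
    exists (one + ray_sum S n)%MM, one; split=> //.
    - by rewrite mem_filter one_two asboolT //=; apply/BP.
    - exact: asgD (omega_mem S Hone) (ray_sum_mem _ _).
    - by rewrite wE r2 /two -addmA addmC.
  exists (ray_sum S n), rho; split=> //.
  - by rewrite mem_filter r2 asboolT //=; apply/BP.
  - exact: ray_sum_mem.
  - by rewrite wE addmC.
(* [f] picks one strip index for each outside exponent; its value elsewhere is the default [i0].
   Over [s] it gives an injection into [Q]. *)
have [f fP] : exists f : 'X_{1..d} -> 'I_d, forall w, outside H b w ->
    ray_coord S (f w) w < ray_coord S (f w) b.
  suff /choice[f fP] : forall w, exists j, outside H b w ->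
      ray_coord S j w < ray_coord S j b by exists f.
  move=> w; have [out|nout] := pselect (outside H b w); last by exists i0.
  by have [j jP] := outside_coord_lt S out; exists j.
have sQ w : in_box S w -> outside H b w -> (w, f w) \in Q.
  by move=> wB out; apply/QP; split=> //; apply: fP.
(* The injection misses a pair: one over [two] if [two] is outside, and otherwise [b = two] and a
   second pair over [one]. This makes [Q] larger than [s]. *)
have [z zQ zs] : exists2 z, z \in Q & z \notin [seq (w, f w) | w <- s].
  have [out2|nout2] := pselect (outside H b two).
    exists (two, f two); first exact: sQ.
    by apply/negP => /mapP[w + [wE _]]; rewrite mem_filter -wE eqxx andbF.
  have b2 : b = two.
    by have [|//|/b1] := out_one two two_omega _ nout2; [move=> i; rewrite mnmDE oneE|].
  have [k kf] : exists k, k != f one.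
    have [k k0] := i1; have [fi|ni] := eqVneq (f one) i0; first by exists k; rewrite fi.
    by exists i0; rewrite eq_sym.
  exists (one, k); first by apply/QP; split=> //; rewrite b2 ray_coordD ltrDl.
  by apply/negP => /mapP[w _ [<- kE]]; rewrite kE eqxx in kf.
have : (size (z :: [seq (w, f w) | w <- s]) <= size Q)%N.
  apply: uniq_leq_size.
    by rewrite /= zs map_inj_uniq ?filter_uniq // => w w' [].
  move=> x; rewrite inE => /orP[/eqP->//|/mapP[w /sP[wB out] ->]].
  exact: sQ.
by rewrite /= size_map ltnNge Qs.
Qed.
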